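(* Let $m$ be a positive integer, $K$ a compact group, and $U\subset K$ a closed subgroup. Let $T$ be the unitary representation of $\mathbb{G}=\varinjlim\mathrm{Aut}(F_n)$ in $L^2(K^\infty//U)$ given by $T(g)f(k)=f(g(k))$, let $H\subset L^2(K^\infty//U)$ be the subspace of functions depending only on $k_1,\dots,k_m$ (so $H\simeq L^2(K^m//U)$, which is $L^2(K^m)$ when $U$ is trivial), let $P$ be the orthogonal projection onto $H$, and let $\overline{T}(g)=P\,T(g)\big|_H:H\to H$ for $g\in\mathbb{G}$. Regard $\overline{T}$ as an operator-valued function on the semigroup $\Gamma_m=\mathbb{H}\setminus\mathbb{G}/\mathbb{H}$ with multiplication $\circ$. Then $\overline{T}$ is a representation of the semigroup $\Gamma_m$ in $H$, that is, $$\overline{T}(g\circ h)=\overline{T}(g)\,\overline{T}(h)\qquad\text{for all } g,h\in\Gamma_m .$$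
   Context: $F_n$ is the free group on $x_1,\dots,x_n$, and $F_\infty=\varinjlim F_n$ is the free group on $x_1,x_2,\dots$. $\mathbb{G}=\varinjlim\mathrm{Aut}(F_n)$ is the group of automorphisms $g$ of $F_\infty$ for which there is an $n$ such that $g$ restricts to an automorphism of $F_n$ and $g(x_i)=x_i$ for all $i>n$; the product is composition, $(gh)(w)=g(h(w))$. $\mathbb{H}=\mathbb{H}_m$ is the subgroup of all $g\in\mathbb{G}$ with $g(x_i)=x_i$ for $1\le i\le m$. Let $\theta_j\in\mathbb{H}$ be the automorphism permuting the generators by the involution that fixes $1,\dots,m$, interchanges $m+i$ with $m+j+i$ for $1\le i\le j$, and fixes all indices greater than $m+2j$. For $g,h\in\mathbb{G}$ the sequence of double cosets $\mathbb{H}g\theta_jh\mathbb{H}$ is eventually constant; its eventual value is denoted $g\circ h\in\Gamma_m=\mathbb{H}\setminus\mathbb{G}/\mathbb{H}$. It depends only on the double cosets of $g$ and $h$, and $\circ$ is an associative operation on $\Gamma_m$. $K$ carries its Haar probability measure, and $K^\infty=K\times K\times\cdots$ the product measure (the Haar probability measure of the compact group $K^\infty$). If $g\in\mathbb{G}$ is given by $x_i\mapsto\gamma_i(x_1,x_2,\dots)$, then $g$ acts on $K^\infty$ by $g(k)=(\gamma_1(k),\gamma_2(k),\dots)$, where $\gamma_i(k)$ is obtained by substituting $k_1,k_2,\dots$ for $x_1,x_2,\dots$ in the word $\gamma_i$. These maps preserve the measure and commute with the action of $U$ by simultaneous conjugation $(k_1,k_2,\dots)\mapsto(uk_1u^{-1},uk_2u^{-1},\dots)$.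 $K^\infty//U$ and $K^m//U$ denote the spaces of orbits of simultaneous conjugation by $U$; $L^2(K^\infty//U)$ is identified with the space of $U$-invariant functions in $L^2(K^\infty)$, and similarly for $K^m//U$. The operator $\overline{T}(g)$ depends only on the double coset $\mathbb{H}g\mathbb{H}$, so $\overline{T}$ is a well-defined function on $\Gamma_m$. *)

(* Defs.v *)
(* MathComp and MathComp-Analysis, with R[i] from mathcomp-real-closed.
   Generators and coordinates are indexed from 0: the generator `xgen i`
   is x_{i+1} and `k i` is k_{i+1}. *)
From HB Require Import structures.
From mathcomp Require Import all_boot all_order all_algebra.
From mathcomp Require Import all_classical all_reals all_analysis.
From mathcomp.real_closed Require Import complex.

Set Implicit Arguments.
Unset Strict Implicit.
Unset Printing Implicit Defensive.

Import Order.TTheory GRing.Theory Num.Theory.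
Import numFieldNormedType.Exports.

Local Open Scope classical_set_scope.
Local Open Scope ring_scope.

(* The free group on I, as the set of reduced words: the letter (i, true) is
   the generator i and the letter (i, false) its inverse. *)
Section FreeGroup.
Variable I : choiceType.
Implicit Types (a b : I * bool) (u v w z : seq (I * bool)).

Definition linv a : I * bool := (a.1, ~~ a.2).

Definition reduced w : bool := sorted (fun a b => b != linv a) w.

Record freeGroup := FreeGroup { fg_val :> seq (I * bool); _ : reduced fg_val }.

HB.instance Definition _ := [isSub of freeGroup for fg_val].
HB.instance Definition _ := [Choice of freeGroup by <:].

Definition push a w : seq (I * bool) :=
  if w is b :: w' then (if b == linv a then w' else a :: w) else [:: a].

Lemma linvK : involutive linv.
Proof. by case=> i b; rewrite /linv negbK. Qed.

Lemma push_reduced a w : reduced w -> reduced (push a w).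
Proof.
case: w => [//|b w] /= rbw; case: eqVneq => [_|ba] /=; last by rewrite ba.
exact: path_sorted rbw.
Qed.

Lemma pushs_reduced u w : reduced w -> reduced (foldr push w u).
Proof. by move=> rw; elim: u => //= a u; exact: push_reduced. Qed.

Lemma push_cons a w : reduced (a :: w) -> push a w = a :: w.
Proof. by case: w => //= b w /andP[/negbTE->]. Qed.

Lemma pushK a w : reduced w -> push a (push (linv a) w) = w.
Proof.
case: w => [|b w] /=; first by rewrite eqxx.
rewrite linvK; case: eqVneq => [->|_] rw; first exact: push_cons.
by rewrite /= eqxx.
Qed.

Lemma pushs_push a z w : reduced w ->
  foldr push w (push a z) = push a (foldr push w z).
Proof.
move=> rw; case: z => [//|b z] /=; case: eqVneq => [->|//].
by rewrite pushK //; exact: pushs_reduced.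
Qed.

Lemma pushs_nil u : reduced u -> foldr push [::] u = u.
Proof.
elim: u => //= a u IHu rau; rewrite IHu; last exact: path_sorted rau.
exact: push_cons.
Qed.

Definition winv w := rev (map linv w).

Lemma winvK : involutive winv.
Proof.
move=> w; rewrite /winv map_rev revK -map_comp map_id_in // => a _.
exact: linvK.
Qed.

Lemma winv_reduced w : reduced w -> reduced (winv w).
Proof.
rewrite /reduced /winv rev_sorted sorted_map; apply: sub_sorted => a b /=.
by apply: contraNN => /eqP/(can_inj linvK)->; rewrite linvK.
Qed.

Lemma pushs_winv u : reduced u -> foldr push u (winv u) = [::].
Proof.
rewrite /winv; elim: u => //= a u IHu rau.
rewrite rev_cons foldr_rcons /= linvK eqxx IHu //; exact: path_sorted rau.
Qed.

Definition fg_one : freeGroup := FreeGroup (isT : reduced [::]).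
Definition fg_mul (x y : freeGroup) : freeGroup :=
  FreeGroup (pushs_reduced x (valP y)).
Definition fg_inv (x : freeGroup) : freeGroup :=
  FreeGroup (winv_reduced (valP x)).

Lemma fg_mulA : associative fg_mul.
Proof.
move=> x y z; apply: val_inj => /=.
elim: (fg_val x) => //= a u IHu; rewrite pushs_push ?IHu //; exact: valP z.
Qed.

Lemma fg_mul1 : left_id fg_one fg_mul.
Proof. by move=> x; apply: val_inj. Qed.

Lemma fg_mulr1 : right_id fg_one fg_mul.
Proof. by move=> x; apply: val_inj; apply: pushs_nil; exact: valP x. Qed.

Lemma fg_mulV : left_inverse fg_one fg_inv fg_mul.
Proof. by move=> x; apply: val_inj; apply: pushs_winv; exact: valP x. Qed.

Lemma fg_mulrV : right_inverse fg_one fg_inv fg_mul.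
Proof.
move=> x; apply: val_inj => /=.
by have := pushs_winv (winv_reduced (valP x)); rewrite winvK.
Qed.

HB.instance Definition _ :=
  isGroup.Build freeGroup fg_mulA fg_mul1 fg_mulr1 fg_mulV fg_mulrV.

Definition fg_gen (i : I) : freeGroup := FreeGroup (isT : reduced [:: (i, true)]).

Definition letter_val (L : groupType) (f : I -> L) a : L :=
  (if a.2 then f a.1 else (f a.1)^-1)%g.

(* The homomorphism extending f : I -> L, i.e. the result of substituting
   f i for the generator i in a word. *)
Definition fg_lift (L : groupType) (f : I -> L) (w : freeGroup) : L :=
  foldr (fun a y => (letter_val f a * y)%g) 1%g w.

Lemma fg_lift_gen (L : groupType) (f : I -> L) (i : I) :
  fg_lift f (fg_gen i) = f i.
Proof. by rewrite /fg_lift /= mulg1. Qed.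

Lemma fg_lift_morphism (L : groupType) (f : I -> L) :
  monoid.monoid_morphism (fg_lift f).
Proof.
split=> // x y; rewrite /fg_lift /=.
elim: (fg_val x) => /= [|a u IHu]; first by rewrite mul1g.
rewrite -mulgA -IHu; case: (foldr push y u) => //= b w.
case: eqVneq => [->|//] /=; rewrite mulgA /letter_val /=.
by case: a.2; rewrite /= ?mulgV ?mulVg mul1g.
Qed.

Lemma fg_lift_uniq (L : groupType) (f : I -> L) (h : freeGroup -> L) :
  monoid.monoid_morphism h -> (forall i, h (fg_gen i) = f i) -> h =1 fg_lift f.
Proof.
move=> [h1 hM] hf; have hV x : h (x^-1)%g = ((h x)^-1)%g.
  by apply: (mulgI (h x)); rewrite -hM !mulgV h1.
case=> w rw; elim: w rw => [|a w IHw] raw.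
  by rewrite -[RHS]h1; congr h; apply: val_inj.
have rw : reduced w by exact: path_sorted raw.
have ra : reduced [:: a] by [].
have -> : FreeGroup raw = (FreeGroup ra * FreeGroup rw)%g.
  by apply: val_inj; rewrite /= push_cons // pushs_nil.
rewrite hM (fg_lift_morphism f).2 IHw; congr (_ * _)%g.
rewrite /fg_lift /= mulg1 /letter_val; case: a {raw} ra => i [] ra /=.
  by rewrite -hf; congr h; apply: val_inj.
by rewrite -hf -hV; congr h; apply: val_inj.
Qed.

End FreeGroup.

Definition Finf := freeGroup nat.

Definition xgen (i : nat) : Finf := fg_gen i.

Definition Fsub (n : nat) : set Finf :=
  [set w | all (fun a : nat * bool => (a.1 < n)%N) (fg_val w)].

(* The group G = lim Aut(F_n); its product is \o. *)
Definition GG : set (Finf -> Finf) :=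
  [set g | [/\ monoid.monoid_morphism g, bijective g &
     exists n, g @` Fsub n = Fsub n /\
       forall i, (n <= i)%N -> g (xgen i) = xgen i]].

Section DoubleCosets.
Variable m : nat.

Definition HH : set (Finf -> Finf) :=
  [set g | GG g /\ forall i, (i < m)%N -> g (xgen i) = xgen i].

Definition dcoset (g : Finf -> Finf) : set (Finf -> Finf) :=
  [set a \o g \o b | a in HH & b in HH].

Definition Gamma : set (set (Finf -> Finf)) := [set dcoset g | g in GG].

Definition theta_index (j i : nat) : nat :=
  if (i < m)%N then i
  else if (i < m + j)%N then (i + j)%N
  else if (i < m + j + j)%N then (i - j)%N
  else i.

Definition theta (j : nat) : Finf -> Finf :=
  fg_lift (fun i => xgen (theta_index j i)).

Definition eventual_dcoset (g h : Finf -> Finf) : set (Finf -> Finf) :=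
  xget set0 [set D | \forall j \near \oo, dcoset (g \o theta j \o h) = D].

(* Some element of the double coset A; `idfun` is a junk value for empty A. *)
Definition dcoset_repr (A : set (Finf -> Finf)) : Finf -> Finf :=
  xget (idfun : Finf -> Finf) A.

Definition circ (A B : set (Finf -> Finf)) : set (Finf -> Finf) :=
  eventual_dcoset (dcoset_repr A) (dcoset_repr B).

End DoubleCosets.

HB.mixin Record isTopologicalGroup G of Group G & PointedTopological G := {
  mulg_continuous : continuous (fun xy : G * G => (xy.1 * xy.2)%g);
  invg_continuous : continuous (fun x : G => (x^-1)%g)
}.

#[short(type="topologicalGroupType")]
HB.structure Definition TopologicalGroup :=
  {G of Group G & PointedTopological G & isTopologicalGroup G}.

Definition closed_subgroup (K : topologicalGroupType) (U : set K) : Prop :=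
  [/\ closed U, U 1%g, (forall x y, U x -> U y -> U (x * y)%g)
    & (forall x, U x -> U (x^-1)%g)].

Definition borel (T : ptopologicalType) : Type := g_sigma_algebraType (@open T).

HB.instance Definition _ (T : ptopologicalType) := Measurable.on (borel T).

Definition regular_probability (T : ptopologicalType) (R : realType)
    (mu : probability (borel T) R) : Prop :=
  forall A : set (borel T), measurable A ->
    mu A = ereal_sup [set mu C | C in [set C : set T | compact C /\ C `<=` A]].

(* Regularity makes the Haar measure unique also when K is not second
   countable; it is automatic when K is metrizable. *)
Definition haar_probability (K : topologicalGroupType) (R : realType)
    (lambda : probability (borel K) R) : Prop :=
  regular_probability lambda /\
  forall (a : K) (A : set (borel K)), measurable A ->
    lambda ((fun x : K => (a * x)%g) @^-1` A) = lambda A.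

Definition Kinf (K : Type) : Type := prod_topology (fun _ : nat => K).

HB.instance Definition _ (K : ptopologicalType) :=
  Pointed.copy (Kinf K) (nat -> K).
HB.instance Definition _ (K : ptopologicalType) :=
  Topological.copy (Kinf K) (prod_topology (fun _ : nat => K)).

(* The product measure, on the Borel sets of K^infty.  When K is not second
   countable these are more than the product sigma-algebra; the extension to
   them is then fixed by regularity. *)
Definition product_probability (K : ptopologicalType) (R : realType)
    (lambda : probability (borel K) R)
    (mu : probability (borel (Kinf K)) R) : Prop :=
  regular_probability mu /\
  forall (n : nat) (A : nat -> set (borel K)), (forall i, measurable (A i)) ->
    mu [set k : Kinf K | forall i, (i < n)%N -> A i (k i)] =
    (\prod_(i < n) lambda (A i))%E.

Definition act (K : groupType) (g : Finf -> Finf) (k : Kinf K) : Kinf K :=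
  fun i => fg_lift k (g (xgen i)).

Definition conj_act (K : groupType) (u : K) (k : Kinf K) : Kinf K :=
  fun i => (u * k i * u^-1)%g.

(* Elements of L^2 are represented by functions; equality in L^2 is equality
   almost everywhere, `f = g %[ae mu]`. *)
Section Representation.
Variables (R : realType) (K : topologicalGroupType).
Variables (mu : probability (borel (Kinf K)) R) (U : set K) (m : nat).
Implicit Types (f p q : borel (Kinf K) -> R[i]).

Definition cmeasurable f : Prop :=
  measurable_fun setT (fun k => complex.Re (f k)) /\
  measurable_fun setT (fun k => complex.Im (f k)).

Definition L2 f : Prop :=
  cmeasurable f /\
  (\int[mu]_k ((ComplexField.Normc.normc (f k) ^+ 2)%:E) < +oo)%E.

Definition cintegral f : R[i] :=
  Complex (\int[mu]_k complex.Re (f k)) (\int[mu]_k complex.Im (f k)).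

Definition inner f q : R[i] := cintegral (fun k => f k * conjc (q k)).

(* L^2(K^infty // U), as the U-invariant elements of L^2(K^infty) *)
Definition L2U f : Prop :=
  L2 f /\ forall u, U u -> (fun k => f (conj_act u k)) = f %[ae mu].

Definition Hsub f : Prop :=
  L2U f /\ exists2 p, cmeasurable p /\
    (forall k k' : Kinf K, (forall i, (i < m)%N -> k i = k' i) -> p k = p k')
    & f = p %[ae mu].

Definition is_orthogonal_projection f p : Prop :=
  Hsub p /\ forall q, Hsub q -> inner (fun k => f k - p k) q = 0.

Definition projH f : borel (Kinf K) -> R[i] :=
  xget (fun _ => 0) [set p | is_orthogonal_projection f p].

Definition Trep (g : Finf -> Finf) f : borel (Kinf K) -> R[i] :=
  fun k => f (act g k).

Definition Tbar (g : Finf -> Finf) f : borel (Kinf K) -> R[i] :=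
  projH (Trep g f).

(* Tbar g depends only on the double coset of g, up to equality almost
   everywhere. *)
Definition Tbar_dcoset (A : set (Finf -> Finf)) f : borel (Kinf K) -> R[i] :=
  Tbar (dcoset_repr A) f.

End Representation.

(* Main.v *)
(** By Nielsen's theorem [GG] is generated by transvections and signed permutations
of the generators, and these preserve [mu]: transvections by left invariance of the
Haar measure, signed permutations because the Haar measure is invariant under
inversion. Hence [T] is unitary.

[K] need not be second countable, so Borel sets of [K^oo] may fail to lie in the
product sigma-algebra; but [mu] is inner regular, so a Borel function depending on
the coordinates in [J] agrees almost everywhere with one measurable for the
sigma-algebra generated by these coordinates. To such functions Fubini applies, and
[P] integrates out the coordinates from [m] on.

If [F] and [Q] depend on the first [n <= m + j] coordinates, [theta_j] moves the
coordinates [m, ..., n - 1] of [F] to ones on which [Q] does not depend, so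
[<T(theta_j) F, Q> = <P F, Q>]. With [F = T(h) f] and [Q = T(g^-1) q] for [f], [q]
in [H] this gives [P T(g theta_j h) f = P T(g) P T(h) f]. *)

Require Import Defs.
From HB Require Import structures.
From mathcomp Require Import all_boot all_order all_algebra.
From mathcomp Require Import all_classical all_reals all_analysis.
From mathcomp.real_closed Require Import complex.
From mathcomp Require Import measurable_realfun zify ring lra.

Set Implicit Arguments.
Unset Strict Implicit.
Unset Printing Implicit Defensive.

Import Order.TTheory GRing.Theory Num.Theory.
Import numFieldNormedType.Exports.

Local Open Scope classical_set_scope.

(** * Nielsen's theorem *)

Section FreeGroupAutomorphisms.
Implicit Types (a b d : nat * bool) (p q r u v w : seq (nat * bool)).
Implicit Types (g h : Finf -> Finf) (x y z : Finf) (n : nat).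

(** The projection onto [H] is computed without [U]. Conjugation by [u] preserves [mu], commutes
    with every [act g] and maps functions of the first [m] coordinates to such functions; hence an
    invariant function has an invariant projection onto the space of all square-integrable functions
    of these coordinates. This projection also respects real and imaginary parts, so the analysis is
    done for real functions, where a projection is characterised by its integrals against functions
    of the first [m] coordinates.

    [projH] and [dcoset_repr] are choices, so both sides of the theorem are known only through such
    characterisations, and they agree because projections are unique almost everywhere. The
    representative chosen for [circ A B] has the form [a \o (g \o theta m j \o h) \o b] with [a],
    [b] in [HH m]; these factors are absorbed by the functions of the first [m] coordinates on
    either side of the inner product. *)

Lemma morphismV (L L' : groupType) (g : L -> L') (x : L) :
  monoid.monoid_morphism g -> g x^-1%g = (g x)^-1%g.
Proof. by move=> [g1 gM]; apply: (mulgI (g x)); rewrite -gM !mulgV g1. Qed.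

Lemma fg_lift_comp (L L' : groupType) (h : L -> L') (f : nat -> L) x :
  monoid.monoid_morphism h -> h (fg_lift f x) = fg_lift (h \o f) x.
Proof.
move=> [h1 hM]; apply: (@fg_lift_uniq _ _ _ (h \o fg_lift f)).
  by split=> [|y z] /=; rewrite ?(fg_lift_morphism f).1 // (fg_lift_morphism f).2 hM.
by move=> i /=; rewrite fg_lift_gen.
Qed.

Lemma morphism_lift (L : groupType) (h : Finf -> L) :
  monoid.monoid_morphism h -> h = fg_lift (h \o xgen).
Proof. by move=> hM; apply/funext/fg_lift_uniq. Qed.

Lemma morphism_ext (L : groupType) (g h : Finf -> L) :
  monoid.monoid_morphism g -> monoid.monoid_morphism h ->
  (forall i, g (xgen i) = h (xgen i)) -> g = h.
Proof.
move=> gM hM gh; rewrite (morphism_lift gM) (morphism_lift hM); congr fg_lift.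
by apply/funext => i /=.
Qed.

Lemma morphism_id : monoid.monoid_morphism (idfun : Finf -> Finf).
Proof. by []. Qed.

Lemma morphism_comp g h : monoid.monoid_morphism g ->
  monoid.monoid_morphism h -> monoid.monoid_morphism (g \o h).
Proof. by move=> [g1 gM] [h1 hM]; split=> [|x y] /=; rewrite ?h1 // hM gM. Qed.

Definition lett a : Finf := FreeGroup (isT : reduced [:: a]).

Lemma lettV a : lett (linv a) = (lett a)^-1%g.
Proof. exact: val_inj. Qed.

Lemma fg_lift_lett (L : groupType) (f : nat -> L) a :
  fg_lift f (lett a) = letter_val f a.
Proof. by rewrite /fg_lift /= mulg1. Qed.

Lemma lett_letter_val a : lett a = letter_val xgen a.
Proof. by case: a => i [] //; rewrite /letter_val /=; apply: val_inj. Qed.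

Lemma all_push (s : pred (nat * bool)) a w :
  s a -> all s w -> all s (push a w).
Proof.
move=> sa; case: w => [|b w] /=; first by rewrite sa.
by case: ifP => _ /andP[sb sw] //=; rewrite sa sb.
Qed.

Lemma FsubM n x y : Fsub n x -> Fsub n y -> Fsub n (x * y)%g.
Proof.
rewrite /Fsub /=; elim: (fg_val x) => //= a u IHu /andP[an un] yn.
by apply: all_push => //; exact: IHu.
Qed.

Lemma FsubV n x : Fsub n x -> Fsub n x^-1%g.
Proof. by rewrite /Fsub /= /winv all_rev all_map. Qed.

Lemma Fsub_lett n a : (a.1 < n)%N -> Fsub n (lett a).
Proof. by rewrite /Fsub /= andbT. Qed.

Lemma Fsub_le n N x : (n <= N)%N -> Fsub n x -> Fsub N x.
Proof. by move=> nN; apply: sub_all => a /leq_trans; exact. Qed.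

Lemma fg_lift_Fsub n N (f : nat -> Finf) x :
  (forall i, (i < n)%N -> Fsub N (f i)) -> Fsub n x -> Fsub N (fg_lift f x).
Proof.
move=> fN; rewrite /fg_lift /Fsub /=; elim: (fg_val x) => //= a u IHu /andP[an un].
apply: (@FsubM N); last exact: IHu.
by rewrite /letter_val; case: a.2; [|apply: FsubV]; exact: fN.
Qed.

Lemma fg_lift_eq_in (L : groupType) n (f f' : nat -> L) x :
  (forall i, (i < n)%N -> f i = f' i) -> Fsub n x -> fg_lift f x = fg_lift f' x.
Proof.
move=> ff'; rewrite /fg_lift /Fsub /=; elim: (fg_val x) => //= a u IHu /andP[an un].
by rewrite IHu // /letter_val ff'.
Qed.

(** The inverse is part of the data and the condition on [Fsub n] is reduced to generators, so the
    rank [n] can be enlarged freely. That [g'] also fixes the generators from [n] on follows by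
    cancellation. *)
Definition autn n g g' := [/\ monoid.monoid_morphism g,
  monoid.monoid_morphism g', cancel g g', cancel g' g &
  forall i, if (i < n)%N then Fsub n (g (xgen i)) /\ Fsub n (g' (xgen i))
            else g (xgen i) = xgen i].

Lemma autn_sym n g g' : autn n g g' -> autn n g' g.
Proof.
case=> gM g'M gK g'K H; split=> // i; have := H i.
by case: ifP => [_ []//|_ {1}<-]; rewrite gK.
Qed.

Lemma autn_Fsub n g g' x : autn n g g' -> Fsub n x -> Fsub n (g x).
Proof.
move=> [gM _ _ _ H]; rewrite (morphism_lift gM); apply: fg_lift_Fsub => i i_n.
by have := H i; rewrite i_n => -[].
Qed.

Lemma autn_comp n g g' h h' :
  autn n g g' -> autn n h h' -> autn n (g \o h) (h' \o g').
Proof.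
move=> ag ah; have ag' := autn_sym ag; have ah' := autn_sym ah.
case: (ag) => gM g'M gK g'K Hg; case: (ah) => hM h'M hK h'K Hh; split.
- exact: morphism_comp.
- exact: morphism_comp.
- exact: can_comp.
- exact: can_comp.
move=> i; have := Hh i; have := Hg i; case: ifP => [_ [gi g'i] [hi h'i]|_ gi hi] /=.
  by split; [exact: autn_Fsub ag _|exact: autn_Fsub ah' _].
by rewrite hi gi.
Qed.

Lemma autn_le n N g g' : (n <= N)%N -> autn n g g' -> autn N g g'.
Proof.
move=> nN ag; have [gM g'M gK g'K H] := ag; split=> // i.
have := H i; case: (ltnP i n) => [i_n|n_i gi].
  by rewrite (leq_trans i_n nN) => -[gi g'i]; split; exact: Fsub_le nN _.
case: ifP => // iN; have g'i : g' (xgen i) = xgen i by rewrite -{1}gi gK.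
by rewrite gi g'i; split; exact: (@Fsub_lett N (i, true)).
Qed.

Lemma GG_autn g : GG g <-> exists n g', autn n g g'.
Proof.
split=> [[gM [g' gK g'K] [n [gn gfix]]]|[n [g' ag]]].
  exists n, g'; split=> //.
    split; first by rewrite -{1}gM.1 gK.
    by move=> x y; apply: (can_inj gK); rewrite gM.2 !g'K.
  move=> i; case: ltnP => [i_n|]; last exact: gfix.
  have xi : Fsub n (xgen i) by exact: (@Fsub_lett n (i, true)).
  split; first by rewrite -gn; exists (xgen i).
  by move: xi; rewrite -{1}gn => -[y yn <-]; rewrite gK.
have ag' := autn_sym ag; have [gM g'M gK g'K H] := ag.
split=> //; first by exists g'.
exists n; split=> [|i ni]; last by have := H i; rewrite ltnNge ni.
apply/seteqP; split=> [_ [x xn <-]|x xn]; first exact: autn_Fsub ag _.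
by exists (g' x) => //; exact: autn_Fsub ag' _.
Qed.

(** The signed letter [b] goes to [a b]. For a negative [b] this multiplies its generator on the
    right by the inverse of [a], so left and right transvections are covered by one formula. *)
Definition transv a b : Finf -> Finf :=
  fg_lift (fun i => if i == b.1 then
     (if b.2 then lett a * lett b else (lett a * lett b)^-1)%g else xgen i).

Lemma transv_morphism a b : monoid.monoid_morphism (transv a b).
Proof. exact: fg_lift_morphism. Qed.

Lemma transv_lett a b d : a.1 != b.1 -> transv a b (lett d) =
  if d == b then (lett a * lett b)%g else
  if d == linv b then (lett a * lett b)^-1%g else lett d.
Proof.
move=> ab; rewrite /transv fg_lift_lett /letter_val.
case: b d ab => i b [j e] /= ab; rewrite !xpair_eqE.
case: (eqVneq j i) => [->|ji] /=.
  by case: b {ab}; case: e => //=; rewrite invgK.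
by rewrite (@lett_letter_val (j,e)) /letter_val.
Qed.

Lemma transvK a b : a.1 != b.1 -> cancel (transv a b) (transv (linv a) b).
Proof.
move=> ab x; suff : transv (linv a) b \o transv a b = idfun :> (Finf -> Finf).
  exact: (congr1 (@^~ x)).
have mV := transv_morphism (linv a) b.
apply: morphism_ext => //.
  by apply: morphism_comp => //; exact: transv_morphism.
move=> i /=; rewrite -/(lett (i,true)) transv_lett //.
have a1 : a != b by apply: contraNneq ab => ->.
have a2 : a != linv b by apply: contraNneq ab => ->.
have E : transv (linv a) b (lett a * lett b)%g = lett b.
  by rewrite mV.2 !transv_lett // (negbTE a1) (negbTE a2) eqxx lettV mulgA mulgV mul1g.
rewrite -/(lett (i, true)); case: eqVneq => [ib|ib]; first by rewrite E -ib.
case: eqVneq => [ib'|ib']; first by rewrite morphismV // E -lettV -ib'.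
by rewrite transv_lett // (negbTE ib) (negbTE ib').
Qed.

Lemma autn_transv n a b : (a.1 < n)%N -> (b.1 < n)%N -> a.1 != b.1 ->
  autn n (transv a b) (transv (linv a) b).
Proof.
move=> an bn ab; split; do ?exact: transv_morphism; first exact: transvK.
  by rewrite -{2}(linvK a); apply: transvK.
have Fi d e : (d.1 < n)%N -> (e.1 < n)%N -> d.1 != b.1 -> Fsub n (transv d b (lett e)).
  move=> dn en db; rewrite transv_lett //.
  have ? : Fsub n (lett d * lett b)%g by apply: FsubM; exact: Fsub_lett.
  by case: eqP => // _; case: eqP => _; [exact: FsubV|exact: Fsub_lett].
move=> i; case: ltnP => [i_n|ni]; first by rewrite -/(lett (i,true)); split; exact: Fi.
rewrite -/(lett (i,true)) transv_lett //.
have ib : i != b.1 by apply: contraTneq bn => <-; rewrite -leqNgt.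
by case: b {bn ab Fi} ib => j e /= ij; rewrite !xpair_eqE (negbTE ij).
Qed.

End FreeGroupAutomorphisms.

Ltac slia := simpl in *; lia.

(** * Cancellation in products of reduced words *)

Section Nielsen.
Implicit Types (a b d : nat * bool) (p q r u v w : seq (nat * bool)).
Implicit Types (g h : Finf -> Finf) (x y z : Finf) (n : nat).

Lemma reduced_catl u v : reduced (u ++ v) -> reduced u.
Proof. by rewrite /reduced => /cat_sorted2[]. Qed.

Lemma reduced_catr u v : reduced (u ++ v) -> reduced v.
Proof. by rewrite /reduced => /cat_sorted2[]. Qed.

(** Being reduced concerns neighbouring letters only, and the nonempty [v] keeps [u] and [w]
    apart. *)
Lemma reduced_overlap u v w : v != [::] ->
  reduced (u ++ v) -> reduced (v ++ w) -> reduced (u ++ v ++ w).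
Proof.
rewrite /reduced; case: v => // a v _; case: u => [//|b u] /=.
rewrite (cat_path _ _ _ (a :: v ++ w)).
rewrite cat_path => /andP[-> /= /andP[-> _]].
by rewrite /= cat_path => ->.
Qed.

Lemma pushs_cat u w : reduced (u ++ w) -> foldr (@push nat) w u = u ++ w.
Proof.
elim: u => //= a u IHu rauw; rewrite IHu; last exact: path_sorted rauw.
exact: push_cons.
Qed.

Lemma winv_cat u v : winv (u ++ v) = winv v ++ winv u.
Proof. by rewrite /winv map_cat rev_cat. Qed.

Lemma size_winv u : size (winv u) = size u.
Proof. by rewrite /winv size_rev size_map. Qed.

Lemma nth_winv u i a : (i < size u)%N ->
  nth a (winv u) i = linv (nth a u (size u - i.+1)).
Proof.
move=> iu; rewrite /winv nth_rev size_map //.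
by rewrite (nth_map a) // ltn_subrL (leq_ltn_trans _ iu).
Qed.

Lemma pushs_winv_cat u v : reduced (u ++ v) -> foldr (@push nat) (u ++ v) (winv u) = v.
Proof.
rewrite /winv; elim: u => //= a u IHu rauv.
rewrite rev_cons foldr_rcons /= linvK eqxx IHu //; exact: path_sorted rauv.
Qed.

Lemma mul_cancel x y p q r : fg_val x = p ++ winv q -> fg_val y = q ++ r ->
  reduced (p ++ r) -> fg_val (x * y)%g = p ++ r.
Proof.
move=> xE yE rpr; rewrite /= xE foldr_cat yE pushs_winv_cat -?yE; last exact: (valP y).
exact: pushs_cat.
Qed.

Lemma mul_decomp x y : exists p q r,
  [/\ fg_val x = p ++ winv q, fg_val y = q ++ r & fg_val (x * y)%g = p ++ r].
Proof.
rewrite /=; have := valP x; rewrite /=; elim: (fg_val x) => [|a u IHu] rau.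
  by exists [::], [::], (fg_val y).
have [|p [q [r [uE yE prE]]]] := IHu; first exact: path_sorted rau.
rewrite /= prE; case: p prE uE => [|b p] prE uE /=.
  case: r yE {prE} => [|b r] yE /=; first by exists [:: a], q, [::]; rewrite uE.
  case: eqVneq => [ba|ba]; last by exists [:: a], q, (b :: r); rewrite uE.
  exists [::], (rcons q b), r; rewrite cat_rcons yE; split=> //.
  by rewrite uE /winv map_rcons rev_rcons ba linvK.
exists (a :: b :: p), q, r; split=> //; first by rewrite uE.
by move: rau; rewrite uE /= => /andP[/negbTE->].
Qed.

(* Number of letters of x that cancel in x * y *)
Definition canc x y : nat :=
  (size (fg_val x) + size (fg_val y) - size (fg_val (x * y)%g))./2.

Lemma cancP x y : exists p q r,
  [/\ fg_val x = p ++ winv q, fg_val y = q ++ r, fg_val (x * y)%g = p ++ r &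
      size q = canc x y].
Proof.
have [p [q [r [xE yE xyE]]]] := mul_decomp x y; exists p, q, r; split=> //.
rewrite /canc xE yE xyE !size_cat size_winv.
have -> : (size p + size q + (size q + size r) - (size p + size r) = (size q).*2)%N.
  by slia.
by rewrite doubleK.
Qed.

Lemma canc_size x y :
  (size (fg_val (x * y)%g) + (canc x y).*2 = size (fg_val x) + size (fg_val y))%N.
Proof.
have [p [q [r [-> -> -> <-]]]] := cancP x y; rewrite !size_cat size_winv; slia.
Qed.

Lemma reduced_square_winv p : reduced (p ++ winv p) -> p = [::].
Proof.
elim/last_ind: p => // p a _.
rewrite /winv map_rcons rev_rcons -cats1 -catA => /reduced_catr /=.
by rewrite eqxx.
Qed.

(** Cancellation pairs the letter at [i] with the inverse of the letter at [s - i - 1]. If it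
    reached the middle of [x], the middle letter would be its own inverse (odd length) or the two
    middle letters would be inverse neighbours (even length). *)
Lemma canc_self x : x != 1%g -> ((canc x x).*2 < size (fg_val x))%N.
Proof.
move=> x1; rewrite ltnNge; apply/negP => H.
have [p [q [r [xE xE' _ qc]]]] := cancP x x; rewrite -qc in H.
set s := size (fg_val x) in H.
have s0 : (0 < s)%N.
  by rewrite /s lt0n size_eq0; apply: contra x1 => /eqP x0; apply/eqP/val_inj.
have qs : (size q <= s)%N by rewrite /s xE' size_cat leq_addr.
have nthx i : (i < size q)%N ->
    nth (0%N, true) (fg_val x) i = linv (nth (0%N, true) (fg_val x) (s - i.+1)).
  move=> iq; have sE : s = (size p + size q)%N by rewrite /s xE size_cat size_winv.
  rewrite {1}xE' nth_cat iq xE nth_cat.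
  have -> : (s - i.+1 < size p)%N = false by slia.
  rewrite nth_winv; last by slia.
  rewrite linvK; congr nth; slia.
have := odd_double_half s; case: (odd s) => sh.
  have := nthx (s./2); have -> : (s - s./2.+1 = s./2)%N by slia.
  have -> : (s./2 < size q)%N by slia.
  by move=> /(_ isT)/(congr1 snd) /=; case: (nth _ _ _).2.
have := nthx (s./2.-1); have -> : (s - s./2.-1.+1 = s./2.-1.+1)%N by slia.
have -> : (s./2.-1 < size q)%N by slia.
move=> /(_ isT) E; have := valP x; rewrite /= /reduced.
move=> /(sortedP (0%N, true)) /(_ (s./2.-1)); rewrite E linvK eqxx.
have -> : (s./2.-1.+1 < size (fg_val x))%N by rewrite -/s; slia.
by move=> /(_ isT).
Qed.

Section Order.
Variable n : nat.

(** The word as a number in base [n.*2], one digit per signed letter: on words of equal length in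
    the first [n] generators this is a lexicographic order. *)
Fixpoint enc w : nat := if w is a :: w' then
  (((a.1).*2 + a.2) * (n.*2) ^ size w' + enc w')%N else 0%N.

Lemma enc_lt w : all (fun a => a.1 < n)%N w -> (enc w < n.*2 ^ size w)%N.
Proof.
elim: w => [//|a w IHw] /= /andP[an /IHw ew].
have : ((a.1).*2 + a.2 < n.*2)%N by case: a.2; slia.
move: ((a.1).*2 + a.2)%N => k kn; rewrite expnS.
apply: (@leq_trans (k.+1 * n.*2 ^ size w)); last by rewrite leq_mul2r kn orbT.
by rewrite mulSn addnC ltn_add2r.
Qed.

Lemma enc_cat p r : enc (p ++ r) = (enc p * n.*2 ^ size r + enc r)%N.
Proof.
elim: p => //= a p ->; rewrite size_cat mulnDl expnD; slia.
Qed.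

Lemma enc_inj p q : size p = size q ->
  all (fun a => a.1 < n)%N p -> all (fun a => a.1 < n)%N q ->
  enc p = enc q -> p = q.
Proof.
elim: p q => [|a p IHp] [|b q] //= [spq] /andP[an pn] /andP[bn qn] E.
have ep := enc_lt pn; have eq := enc_lt qn; rewrite spq in E ep.
have ab : ((a.1).*2 + a.2 = (b.1).*2 + b.2)%N.
  have := congr1 (divn^~ (n.*2 ^ size q)) E.
  by rewrite /= !divnMDl ?(leq_ltn_trans _ ep) // !divn_small // !addn0.
rewrite (IHp q) //; last by move: E; rewrite ab => /addnI.
case: a b ab {E an bn} => i [] [j []] /= H; congr (_ :: _); congr (_, _); slia.
Qed.

Definition half_enc w := enc (take (uphalf (size w)) w).

(* Breaks ties between automorphisms of equal total length, where no transvection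
   shortens an image but a generator can cancel entirely, one half against each
   neighbour *)
Definition weight w := (half_enc w + half_enc (winv w))%N.

Lemma weight_winv w : weight (winv w) = weight w.
Proof. by rewrite /weight winvK addnC. Qed.

(** As [q] is no longer than [r], it lies in the first half of the word, while the first half of the
    inverse word is read off [r] alone. So only one summand of [weight] changes, and it does so in
    its leading digits. *)
Lemma weight_lt p q r : size p = size q -> (size q <= size r)%N ->
  all (fun a => a.1 < n)%N (p ++ r) ->
  (enc p < enc q)%N -> (weight (p ++ r) < weight (q ++ r))%N.
Proof.
move=> pq qr; rewrite all_cat => /andP[_ rn] epq.
(* The base [n.*2] may vanish, but then [r] is empty and the power to be cancelled is one. *)
have {rn} : (0 < n)%N \/ r = [::].
  by case: n rn => [|k] rn; [right; case: (r) rn|left].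
move=> rn.
rewrite /weight /half_enc !winv_cat !size_cat !size_winv pq [(size r + _)%N]addnC /=.
set s := uphalf _.
have sr : (s <= size r)%N by rewrite /s; have := uphalf_half (size q + size r);
  have := odd_double_half (size q + size r); case: odd => /=; slia.
have sq : (size q <= s)%N by rewrite /s; have := uphalf_half (size q + size r);
  have := odd_double_half (size q + size r); case: odd => /=; slia.
have takeE w : take s (winv r ++ w) = take s (winv r).
  by rewrite takel_cat // size_winv.
have sqF : (s < size q)%N = false by rewrite ltnNge sq.
rewrite !takeE ltn_add2r !take_cat pq sqF !enc_cat.
rewrite ltn_add2r ltn_mul2r epq andbT expn_gt0 double_gt0.
by case: rn => [->//|->]; rewrite orbT.
Qed.

End Order.

End Nielsen.

(** * Automorphisms that no transvection improves *)

Section NielsenMinimal.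
Variables (n : nat) (g g' : Finf -> Finf).
Hypothesis ag : autn n g g'.
Implicit Types (a b d : nat * bool) (p q r u v w : seq (nat * bool)).

Local Notation G a := (g (lett a)).
Local Notation len x := (size (fg_val x)).

Let gM : monoid.monoid_morphism g. Proof. by case: ag. Qed.

Let GV a : G (linv a) = (G a)^-1%g.
Proof. by rewrite lettV morphismV. Qed.

Let sizeV (x : Finf) : len x^-1%g = len x.
Proof. by rewrite /= size_winv. Qed.

Let valV (x : Finf) : fg_val x^-1%g = winv (fg_val x).
Proof. by []. Qed.

Let G1 a : G a != 1%g.
Proof.
have [[g1 _] _ gK _ _] := ag.
by apply/eqP => E; have := gK (lett a); rewrite E -g1 gK => /(congr1 (@fg_val nat)).
Qed.

Let Gn a : (a.1 < n)%N -> all (fun a => a.1 < n)%N (fg_val (G a)).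
Proof. by move=> an; have := autn_Fsub ag (Fsub_lett an). Qed.

Hypothesis size_min : forall a b, (a.1 < n)%N -> (b.1 < n)%N -> a.1 != b.1 ->
  (len (G b) <= len ((G a * G b)%g))%N.
Hypothesis weight_min : forall a b, (a.1 < n)%N -> (b.1 < n)%N -> a.1 != b.1 ->
  len ((G a * G b)%g) = len (G b) ->
  (weight n (fg_val (G b)) <= weight n (fg_val (G a * G b)%g))%N.

(** Minimality bounds the length of the product below by that of [G b] and, through the inverse
    product, by that of [G a]; hence at most half of either factor cancels. *)
Let canc_half a b : (a.1 < n)%N -> (b.1 < n)%N -> a.1 != b.1 ->
  ((canc (G a) (G b)).*2 <= len (G a))%N /\ ((canc (G a) (G b)).*2 <= len (G b))%N.
Proof.
move=> an bn ab; have := canc_size (G a) (G b); have := size_min an bn ab.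
have := size_min (a := linv b) (b := linv a) bn an; rewrite eq_sym => /(_ ab).
rewrite !GV -invgM !sizeV; slia.
Qed.

Let canc_lt a b : (a.1 < n)%N -> (b.1 < n)%N -> b != linv a ->
  (canc (G a) (G b) < len (G a))%N /\ (canc (G a) (G b) < len (G b))%N.
Proof.
move=> an bn ab.
have pos d : (0 < len (G d))%N.
  by rewrite lt0n size_eq0; apply: contra (G1 d) => /eqP d0; apply/eqP/val_inj.
have := pos a; have := pos b.
have [ab1|ab1] := eqVneq a.1 b.1; last by have := canc_half an bn ab1; slia.
have -> : b = a.
  case: a b ab1 ab {an bn} => i e [j f] /= ->; rewrite xpair_eqE eqxx /=.
  by case: e f => [] [].
by have := canc_self (G1 a); slia.
Qed.

(** If its neighbours cancelled all of [G b], each would take exactly half, and [G b] would be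
    [q1 ++ winv q2] with [q1], [q2] of equal length. The smaller of the two could replace the other
    at the head of [G d] or of the inverse of [G a], at equal length and lower weight; and [q1 = q2]
    would make [G b] trivial. *)
Let canc_mid a b d : (a.1 < n)%N -> (b.1 < n)%N -> (d.1 < n)%N ->
  b != linv a -> d != linv b ->
  (canc (G a) (G b) + canc (G b) (G d) < len (G b))%N.
Proof.
move=> an bn dn ab bd; rewrite ltnNge; apply/negP => H.
(* Equal neighbours cancel strictly less than half of each other, so the bound can fail only if both
   pairs involve distinct generators. *)
have half e f : (e.1 < n)%N -> (f.1 < n)%N -> f != linv e ->
    (e.1 != f.1) || ((canc (G e) (G f)).*2 < len (G e))%N && (e == f).
  move=> en fn ef; have [ef1|//] := eqVneq e.1 f.1.
  have -> : f = e.
    case: e f ef1 ef {en fn} => i s [j t] /= ->; rewrite xpair_eqE eqxx /=.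
    by case: s t => [] [].
  by rewrite canc_self // eqxx.
have [ab1 bd1] : a.1 != b.1 /\ b.1 != d.1.
  have /orP[ab1|/andP[A /eqP abE]] := half _ _ an bn ab.
    have /orP[bd1|/andP[B /eqP bdE]] := half _ _ bn dn bd; first by [].
    by have := canc_half an bn ab1; slia.
  rewrite abE in A H; have /orP[bd1|/andP[B /eqP bdE]] := half _ _ bn dn bd.
    by have := canc_half bn dn bd1; slia.
  by rewrite -bdE in B H; slia.
have [H1 H2] := canc_half an bn ab1; have [H3 H4] := canc_half bn dn bd1.
have [p1 [q1 [r1 [aE bE abE c1]]]] := cancP (G a) (G b).
have [p2 [q2 [r2 [bE' dE bdE c2]]]] := cancP (G b) (G d).
have sb := congr1 size bE'; rewrite size_cat size_winv in sb.
have sb' := congr1 size bE; rewrite size_cat in sb'.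
have sa := congr1 size aE; rewrite size_cat size_winv in sa.
have sd := congr1 size dE; rewrite size_cat in sd.
have s12 : size p2 = size q1 by slia.
have /eqP : p2 ++ winv q2 = q1 ++ r1 by rewrite -bE -bE'.
rewrite eqseq_cat // => /andP[/eqP p2E /eqP r1E]; subst p2 r1.
have sq : size q1 = size q2 by slia.
have q1n : all (fun a => a.1 < n)%N q1 by have := Gn bn; rewrite bE all_cat => /andP[].
have q2n : all (fun a => a.1 < n)%N q2 by have := Gn dn; rewrite dE all_cat => /andP[].
have [lt12|lt21|E12] := ltngtP (enc n q1) (enc n q2).
- have r2n : all (fun a => a.1 < n)%N r2 by have := Gn dn; rewrite dE all_cat => /andP[].
  have := weight_min bn dn bd1; rewrite bdE dE !size_cat sq => /(_ erefl).
  by rewrite leqNgt weight_lt //; [slia|rewrite all_cat q1n].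
- have p1n : all (fun a => a.1 < n)%N (winv p1).
    by have := Gn an; rewrite aE all_cat /winv !all_rev !all_map => /andP[].
  have abV : fg_val (G (linv b) * G (linv a))%g = q2 ++ winv p1.
    by rewrite !GV -invgM valV abE winv_cat winvK.
  have aV : fg_val (G (linv a)) = q1 ++ winv p1.
    by rewrite GV /= aE winv_cat winvK.
  have := weight_min (a := linv b) (b := linv a) bn an.
  rewrite eq_sym => /(_ ab1); rewrite abV aV !size_cat sq => /(_ erefl).
  by rewrite leqNgt weight_lt //; [rewrite size_winv; slia|rewrite all_cat q2n].
have q12 : q1 = q2 by exact: enc_inj E12.
have := valP (G b); rewrite /= bE q12 => /reduced_square_winv q20.
by move/eqP: (G1 b); apply; apply: val_inj; rewrite /= bE q12 q20.
Qed.

Let lett_rcons w a (wa : reduced (rcons w a)) (rw : reduced w) :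
  FreeGroup wa = (FreeGroup rw * lett a)%g.
Proof.
apply: val_inj; rewrite /= pushs_cat ?cats1 //.
Qed.

(** The uncancelled end of the last factor survives as a suffix of the image. Hence one more letter
    cancels exactly as in a product of two letters: by [canc_mid] a nonempty piece of the previous
    factor stays in between, and this piece pays for the growth of [s]. *)
Let product_tail w b a (r : reduced (rcons (rcons w b) a)) :
  all (fun a => a.1 < n)%N (rcons (rcons w b) a) ->
  exists s, fg_val (g (FreeGroup r)) = s ++ drop (canc (G b) (G a)) (fg_val (G a))
    /\ (size w < size s)%N.
Proof.
elim/last_ind: w b a r => [|w e IHw] b a r.
  move=> /= /and3P[bn an _].
  have ab : a != linv b by have := r; rewrite /= andbT.
  have -> : FreeGroup r = (lett b * lett a)%g.
    by apply: val_inj => /=; rewrite (negbTE ab).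
  rewrite gM.2; have [p [q [s [bE aE baE c]]]] := cancP (G b) (G a).
  exists p; rewrite baE -c aE drop_size_cat //; split=> //.
  have [+ _] := canc_lt bn an ab; rewrite -c bE size_cat size_winv; slia.
rewrite !all_rcons => /and4P[an bn en wn].
have rb : reduced (rcons (rcons w e) b).
  by have := r; rewrite -cats1 => /reduced_catl.
have [|s [sE sw]] := IHw e b rb; first by rewrite !all_rcons bn en.
have ab : a != linv b.
  have := r; rewrite -!cats1 -!catA => /reduced_catr/reduced_catr /=.
  by rewrite andbT.
have be : b != linv e.
  have := rb; rewrite -!cats1 -!catA => /reduced_catr /=.
  by rewrite andbT.
have cm := canc_mid en bn an be ab.
rewrite (lett_rcons r rb) gM.2.
have [p [q [t [bE aE baE c]]]] := cancP (G b) (G a).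
have [p0 [q0 [t0 [eE bE' ebE c0]]]] := cancP (G e) (G b).
have sb := congr1 size bE'; rewrite size_cat in sb.
have sb2 := congr1 size bE; rewrite size_cat size_winv in sb2.
have pE : p = q0 ++ drop (size q0) p.
  have : take (size q0) (p ++ winv q) = take (size q0) (q0 ++ t0) by rewrite -bE -bE'.
  rewrite [RHS]take_size_cat // takel_cat; last by slia.
  by move=> q0E; rewrite -{1}q0E cat_take_drop.
have t0E : t0 = drop (size q0) p ++ winv q.
  have : drop (size q0) (q0 ++ t0) = drop (size q0) (p ++ winv q) by rewrite -bE -bE'.
  by rewrite [LHS]drop_size_cat // {1}pE -catA drop_size_cat.
(* The piece of [G b] left over by both [G e] and [G a]. *)
have nz : drop (size q0) p != [::].
  rewrite -size_eq0 size_drop -lt0n subn_gt0; slia.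
rewrite -c aE drop_size_cat // in sE *.
exists (s ++ drop (size q0) p); split.
  rewrite -catA; rewrite -c0 bE' drop_size_cat // t0E catA in sE.
  rewrite catA; apply: (mul_cancel sE aE).
  rewrite -catA; apply: reduced_overlap => //.
    by have := valP (g (FreeGroup rb)); rewrite /= sE => /reduced_catl.
  have rpt : reduced (p ++ t) by rewrite -baE; exact: (valP (G b * G a)%g).
  by rewrite pE -catA in rpt; exact: reduced_catr rpt.
rewrite size_rcons size_cat.
by move: nz; rewrite -size_eq0; slia.
Qed.

Lemma minimal_size w (r : reduced w) : all (fun a => a.1 < n)%N w ->
  (size w <= len (g (FreeGroup r)))%N.
Proof.
case/lastP: w r => [//|w a] r; case/lastP: w r => [|w b] r H.
  rewrite size_rcons lt0n size_eq0; apply: contra (G1 a) => /eqP E.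
  by apply/eqP/val_inj; rewrite /= -E; congr (fg_val (g _)); apply: val_inj.
have [s [-> sw]] := product_tail r H; rewrite size_cat !size_rcons.
have ab : a != linv b.
  have := r; rewrite -!cats1 -!catA => /reduced_catr /=.
  by rewrite andbT.
have [an bn] : (a.1 < n /\ b.1 < n)%N by move: H; rewrite !all_rcons => /and3P[].
have [_] := canc_lt bn an ab; rewrite size_drop; slia.
Qed.

(** For [i < n], [g] takes [g' (xgen i)] to a single letter, and by [minimal_size] it shortens no
    word in the first [n] generators. *)
Lemma minimal_lett i : exists b, g' (xgen i) = lett b.
Proof.
have [gM' _ gK g'K H] := ag; have := H i; case: ltnP => [i_n [_ g'i]|_ gi]; last first.
  by exists (i, true); rewrite -gi gK.
have : (len (g' (xgen i)) <= 1)%N.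
  have := @minimal_size (fg_val (g' (xgen i))) (valP (g' (xgen i))) g'i.
  set x := FreeGroup _; have -> : x = g' (xgen i) by apply: val_inj.
  by rewrite g'K.
have : g' (xgen i) != 1%g.
  apply/eqP => E; have := g'K (xgen i); rewrite E gM'.1.
  by move/(congr1 (@fg_val nat)).
case: (g' (xgen i)) => -[|a [|//]] r.
  by case/eqP; apply: val_inj.
by move=> _ _; exists a; apply: val_inj.
Qed.

End NielsenMinimal.

(** * Descent along transvections *)

Section NielsenInduction.
Implicit Types (a b d : nat * bool) (g : Finf -> Finf).

(** Applied with [W] the length and the weight: only the image of the generator [b.1] changes. The
    terms added on both sides avoid subtraction. *)
Lemma transv_sum n g (W : Finf -> nat) a b : monoid.monoid_morphism g ->
  (forall x, W x^-1%g = W x) -> a.1 != b.1 -> (b.1 < n)%N ->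
  (\sum_(i < n) W (g (transv a b (xgen i))) + W (g (lett b)) =
   \sum_(i < n) W (g (xgen i)) + W (g (lett a) * g (lett b))%g)%N.
Proof.
move=> gM WV ab bn; rewrite (bigD1 (Ordinal bn)) //= [in RHS](bigD1 (Ordinal bn)) //=.
rewrite (eq_bigr (fun i : 'I_n => W (g (xgen i)))); last first.
  move=> i ib; congr (W (g _)); rewrite -/(lett (nat_of_ord i, true)) transv_lett //.
  have {}ib : i != b.1 :> nat by [].
  by case: b {ab bn} ib => j e /= ij; rewrite !xpair_eqE (negbTE ij).
have -> : W (g (xgen b.1)) = W (g (lett b)).
  rewrite (lett_letter_val b) /letter_val; case: ifP => // _.
  by rewrite morphismV // WV.
have -> : W (g (transv a b (xgen b.1))) = W (g (lett a) * g (lett b))%g; last by lia.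
rewrite -gM.2 /transv /xgen fg_lift_gen eqxx; case: ifP => // _.
by rewrite morphismV // WV.
Qed.

(* Nielsen's theorem that transvections and signed permutations generate *)
Lemma nielsen_ind (P : (Finf -> Finf) -> Prop) :
  (forall n g g', autn n g g' -> (forall i, exists b, g' (xgen i) = lett b) -> P g) ->
  (forall g a b, a.1 != b.1 -> monoid.monoid_morphism g ->
     P (g \o transv a b) -> P g) ->
  forall g, GG g -> P g.
Proof.
move=> Pbase Pstep g /GG_autn[n [g' ag]].
pose w1 g := (\sum_(i < n) size (fg_val (g (xgen i))))%N.
pose w2 g := (\sum_(i < n) weight n (fg_val (g (xgen i))))%N.
(* Lexicographic descent on total length, then total weight. It stops at an automorphism that
   satisfies both minimality hypotheses of [minimal_lett]. *)
have [k kg] := ubnP (w1 g); elim: k => // k IHk in g g' ag kg *.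
have [l lg] := ubnP (w2 g); elim: l => // l IHl in g g' ag kg lg *.
have [gM _ _ _ _] := ag.
pose progress a b := [/\ (a.1 < n)%N, (b.1 < n)%N & a.1 != b.1] /\
  (w1 (g \o transv a b) < w1 g \/
   w1 (g \o transv a b) = w1 g /\ w2 (g \o transv a b) < w2 g)%N.
have [[a [b [[an bn ab] H]]]|noprog] := pselect (exists a b, progress a b).
  apply: (Pstep _ a b) => //; have at_ := autn_comp ag (autn_transv an bn ab).
  case: H => [lt1|[eq1 lt2]]; first by apply: (IHk _ _ at_); lia.
  by apply: (IHl _ _ at_); lia.
have s1 a b := @transv_sum n g (fun x => size (fg_val x)) a b gM
  (fun x => @size_winv (fg_val x)).
have s2 a b := @transv_sum n g (fun x => weight n (fg_val x)) a b gM
  (fun x => @weight_winv n (fg_val x)).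
apply: (Pbase n g g' ag); apply: (minimal_lett ag) => a b an bn ab.
  rewrite leqNgt; apply/negP => H; apply: noprog; exists a, b; split=> //; left.
  by have := s1 a b ab bn; rewrite /w1 /=; slia.
move=> E; rewrite leqNgt; apply/negP => H; apply: noprog; exists a, b; split=> //.
by right; have := s1 a b ab bn; have := s2 a b ab bn; rewrite /w1 /w2 /=; slia.
Qed.

End NielsenInduction.

(** * Double cosets *)

Section DoubleCosetFacts.
Implicit Types (g h : Finf -> Finf) (s t : nat -> nat) (n m : nat).

Definition perm_aut s : Finf -> Finf := fg_lift (xgen \o s).

Lemma perm_aut_comp s t : perm_aut (s \o t) = perm_aut s \o perm_aut t.
Proof.
apply: morphism_ext; first exact: fg_lift_morphism.
  by apply: morphism_comp; exact: fg_lift_morphism.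
by move=> i; rewrite /= /perm_aut /xgen !fg_lift_gen.
Qed.

Lemma perm_autK s t : cancel s t -> cancel (perm_aut s) (perm_aut t).
Proof.
move=> sK x; rewrite -[LHS]/((perm_aut t \o perm_aut s) x) -perm_aut_comp.
rewrite (_ : t \o s = id); last by apply/funext => i /=.
by rewrite -[RHS]/(idfun x) (morphism_lift morphism_id).
Qed.

Lemma autn_perm n s t : cancel s t -> cancel t s ->
  (forall i, (i < n)%N -> (s i < n)%N) -> (forall i, (n <= i)%N -> s i = i) ->
  autn n (perm_aut s) (perm_aut t).
Proof.
move=> sK tK sn sfix; split; [exact: fg_lift_morphism|exact: fg_lift_morphism| | |].
- exact: perm_autK.
- exact: perm_autK.
move=> i; rewrite /perm_aut /xgen !fg_lift_gen /=; case: ltnP => [i_n|/sfix->//].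
split; first exact: (@Fsub_lett n (s i, true) (sn _ i_n)).
apply: (@Fsub_lett n (t i, true)); rewrite /= ltnNge; apply/negP => nt.
by have := tK i; rewrite sfix // => E; rewrite E leqNgt i_n in nt.
Qed.

(** An injection that fixes the indices below [n] maps the remaining ones among themselves, and
    there [g] fixes the generators. *)
Lemma perm_aut_commute n g g' s : autn n g g' -> injective s ->
  (forall i, (i < n)%N -> s i = i) -> perm_aut s \o g = g \o perm_aut s.
Proof.
move=> [gM _ _ _ H] s_inj sfix; have sM := fg_lift_morphism (xgen \o s).
apply: morphism_ext; [exact: morphism_comp|exact: morphism_comp|move=> i /=].
rewrite /perm_aut [in RHS]/xgen fg_lift_gen /=.
have := H i; case: ltnP => [i_n [gi _]|ni gi].
  rewrite sfix // (fg_lift_eq_in (f' := xgen) _ gi); last first.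
    by move=> l ln; rewrite /= sfix.
  by rewrite -[RHS]/(idfun _) (morphism_lift morphism_id).
rewrite gi {1}/xgen fg_lift_gen /=; have := H (s i).
case: ltnP => [si|//]; suff : s i = i by move=> E; rewrite E ltnNge ni in si.
by apply: s_inj; rewrite sfix.
Qed.

Lemma GG_comp g h : GG g -> GG h -> GG (g \o h).
Proof.
move=> /GG_autn[n [g' ag]] /GG_autn[n' [h' ah]]; apply/GG_autn.
exists (maxn n n'), (h' \o g').
by apply: autn_comp; [apply: autn_le ag|apply: autn_le ah]; rewrite ?leq_maxl ?leq_maxr.
Qed.

Lemma GG_id : GG idfun.
Proof. by apply/GG_autn; exists 0%N, idfun; split. Qed.

Lemma GG_inv g : GG g -> exists g', [/\ GG g', cancel g g' & cancel g' g].
Proof.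
move=> /GG_autn[n [g' ag]]; exists g'; have [_ _ gK g'K _] := ag; split=> //.
by apply/GG_autn; exists n, g; exact: autn_sym.
Qed.

Lemma GG_morphism g : GG g -> monoid.monoid_morphism g.
Proof. by case. Qed.

Variable m : nat.
Local Notation HH := (HH m).
Local Notation dcoset := (dcoset m).
Local Notation theta := (theta m).

Lemma HH_id : HH idfun.
Proof. by split=> //; exact: GG_id. Qed.

Lemma HH_comp g h : HH g -> HH h -> HH (g \o h).
Proof.
move=> [Gg gx] [Gh hx]; split=> [|i im /=]; first exact: GG_comp.
by rewrite hx // gx.
Qed.

Lemma HH_inv g : HH g -> exists g', [/\ HH g', cancel g g' & cancel g' g].
Proof.
move=> [Gg gx]; have [g' [Gg' gK g'K]] := GG_inv Gg.
by exists g'; split=> //; split=> // i im; rewrite -{1}(gx _ im) gK.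
Qed.

Lemma dcoset_refl g : dcoset g g.
Proof. by exists idfun; [exact: HH_id|exists idfun; [exact: HH_id|]]. Qed.

Lemma dcoset_translate a g b : HH a -> HH b -> dcoset (a \o g \o b) = dcoset g.
Proof.
move=> Ha Hb; have [a' [Ha' aK a'K]] := HH_inv Ha; have [b' [Hb' bK b'K]] := HH_inv Hb.
apply/seteqP; split=> _ [c Hc [d Hd <-]].
  by exists (c \o a); [exact: HH_comp|exists (b \o d); [exact: HH_comp|]].
exists (c \o a'); first exact: HH_comp.
exists (b' \o d); first exact: HH_comp.
by apply/funext => x /=; rewrite aK b'K.
Qed.

Lemma theta_indexK j : involutive (theta_index m j).
Proof.
move=> i; rewrite [theta_index m j i]/theta_index; repeat (case: ifP => ?);
  rewrite /theta_index; by repeat (case: ifP => ?); lia.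
Qed.

Lemma autn_theta j : autn (m + j + j) (theta j) (theta j).
Proof.
apply: autn_perm; [exact: theta_indexK|exact: theta_indexK| |] => i;
  by rewrite /theta_index; repeat (case: ifP => ?); lia.
Qed.

Lemma GG_theta j : GG (theta j).
Proof. by apply/GG_autn; exists (m + j + j)%N, (theta j); exact: autn_theta. Qed.

(* The transposition r of the blocks n + j and n + J satisfies
   theta J = s \o theta j \o r with s and r fixing the first n letters, and
   these commute with g and h. *)
Lemma dcoset_theta_far n g g' h h' j J : autn n g g' -> autn n h h' ->
  (m <= n)%N -> (n <= j)%N -> (j + n <= J)%N ->
  dcoset (g \o theta J \o h) = dcoset (g \o theta j \o h).
Proof.
move=> ag ah mn nj jJ.
pose r l := if (l < m + j)%N then l else if (l < n + j)%N then (l - j + J)%N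
  else if (l < m + J)%N then l else if (l < n + J)%N then (l - J + j)%N else l.
have rK : involutive r.
  move=> i; rewrite [r i]/r; repeat (case: ifP => ?); rewrite /r;
    by repeat (case: ifP => ?); lia.
pose s := theta_index m J \o r \o theta_index m j.
pose t := theta_index m j \o r \o theta_index m J.
have sK : cancel s t by move=> i; rewrite /s /t /= theta_indexK rK theta_indexK.
have tK : cancel t s by move=> i; rewrite /s /t /= theta_indexK rK theta_indexK.
have rfix i : (i < n)%N -> r i = i.
  by move=> i_n; rewrite /r; repeat (case: ifP => ?); lia.
have sfix i : (i < n)%N -> s i = i.
  move=> i_n; rewrite /s /=; have [im|mi] := ltnP i m.
    have tE l : theta_index m l i = i by rewrite /theta_index im.
    by rewrite tE rfix ?tE //; lia.
  have -> : theta_index m j i = (i + j)%N.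
    by rewrite /theta_index; repeat (case: ifP => ?); lia.
  have -> : r (i + j)%N = (i + J)%N.
    by rewrite /r; repeat (case: ifP => ?); lia.
  by rewrite /theta_index; repeat (case: ifP => ?); lia.
pose M := (m + J + J + n)%N.
have rM : autn M (perm_aut r) (perm_aut r).
  by apply: autn_perm => // i iM; rewrite /r /M in iM *; repeat (case: ifP => ?); lia.
have thM l : (l <= J)%N -> autn M (theta l) (theta l).
  by move=> lJ; apply: autn_le (autn_theta l); rewrite /M; lia.
have sE : perm_aut s = theta J \o perm_aut r \o theta j.
  by rewrite /s !perm_aut_comp.
have Hr : HH (perm_aut r).
  split; first by apply/GG_autn; exists M, (perm_aut r).
  by move=> i im; rewrite /perm_aut /xgen fg_lift_gen /= rfix //; lia.
have Hs : HH (perm_aut s).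
  split; last by move=> i im; rewrite /perm_aut /xgen fg_lift_gen /= sfix //; lia.
  rewrite sE; apply: GG_comp; last exact: GG_theta.
  by apply: GG_comp; [exact: GG_theta|have [] := Hr].
rewrite -(dcoset_translate (g \o theta j \o h) Hs Hr); congr dcoset.
have rh y : perm_aut r (h y) = h (perm_aut r y).
  exact: (congr1 (@^~ y) (perm_aut_commute ah (can_inj rK) rfix)).
have sg y : perm_aut s (g y) = g (perm_aut s y).
  exact: (congr1 (@^~ y) (perm_aut_commute ag (can_inj sK) sfix)).
apply/funext => x /=; rewrite -rh sg sE /=; congr (g _).
have [_ _ rAK _ _] := rM; have [_ _ tAK _ _] := autn_theta j.
by rewrite tAK rAK.
Qed.

Lemma eventual_dcosetE g h N : GG g -> GG h ->
  exists2 j, (N <= j)%N & eventual_dcoset m g h = dcoset (g \o theta j \o h).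
Proof.
move=> /GG_autn[n1 [g' ag]] /GG_autn[n2 [h' ah]].
pose n := (m + n1 + n2)%N.
have {}ag : autn n g g' by apply: autn_le ag; rewrite /n; lia.
have {}ah : autn n h h' by apply: autn_le ah; rewrite /n; lia.
have mn : (m <= n)%N by rewrite /n; lia.
pose D0 := dcoset (g \o theta n \o h).
have D0P : \forall j \near \oo, dcoset (g \o theta j \o h) = D0.
  (* [dcoset_theta_far] needs a gap between the two indices, so [theta j] and [theta n] are both
     compared with [theta (j + n)]. *)
  exists n => // j /= nj.
  have E1 := dcoset_theta_far ag ah mn nj (leqnn (j + n)).
  have nn : (n + n <= j + n)%N by rewrite leq_add2r.
  exact: etrans (esym E1) (dcoset_theta_far ag ah mn (leqnn n) nn).
have [n0 _ H] : \forall j \near \oo, dcoset (g \o theta j \o h) = eventual_dcoset m g h.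
  apply: (xgetPex set0 (P := [set D | \forall j \near \oo, dcoset (g \o theta j \o h) = D])).
  by exists D0.
by exists (maxn N n0); rewrite ?leq_maxl // H //= leq_maxr.
Qed.

Lemma dcoset_reprP g : dcoset g (dcoset_repr (dcoset g)).
Proof. by apply: xgetPex; exists g; exact: dcoset_refl. Qed.

Lemma dcoset_GG g a : GG g -> dcoset g a -> GG a.
Proof.
move=> Gg [b [Gb _] [c [Gc _] <-]]; apply: GG_comp => //; exact: GG_comp.
Qed.

End DoubleCosetFacts.

(** * Regular Borel measures on the product space *)

Local Open Scope ring_scope.
Local Open Scope ereal_scope.

(** Finite subcovers in the form of an induction principle. If [Q C] failed, the sets whose
    complement in [C] satisfies [Q] would form a proper filter containing [C], and a cluster point
    of it in [C] would contradict the local hypothesis. *)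
Lemma compact_ind (T : topologicalType) (C : set T) (Q : set (set T)) :
  compact C -> Q set0 -> (forall A B, Q A -> Q B -> Q (A `|` B)) ->
  (forall A B, A `<=` B -> Q B -> Q A) ->
  (forall c, C c -> exists2 V, nbhs c V & Q (C `&` V)) -> Q C.
Proof.
move=> cC Q0 QU QS Qloc; apply: contrapT => nQC.
pose F : set_system T := [set A | Q (C `\` A)].
have FF : ProperFilter F.
  split; first by rewrite /F /= setD0.
  split; first by rewrite /F /= setDT.
    by move=> A B; rewrite /F /= setDIr; exact: QU.
  by move=> A B AB; apply: QS; exact: setDS.
have FC : F C by rewrite /F /= setDv.
have [c [Cc clc]] := cC F FF FC.
have [V cV QV] := Qloc c Cc.
have FnV : F (~` V) by rewrite /F /= setDE setCK.
by have [x []] := clc _ _ FnV cV.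
Qed.

(** [S] is a lattice of open sets rather than all of them, so that the separating sets can be kept
    inside a smaller sigma-algebra. *)
Lemma compact_separation (T : topologicalType) (S : set (set T)) (C D : set T) :
  (forall A B, S A -> S B -> S (A `|` B)) -> (forall A B, S A -> S B -> S (A `&` B)) ->
  S set0 -> S setT -> S `<=` open -> compact C -> compact D ->
  (forall c d, C c -> D d -> exists A B, [/\ S A, S B, A c, B d & A `&` B = set0]) ->
  exists A B, [/\ S A, S B, C `<=` A, D `<=` B & A `&` B = set0].
Proof.
move=> SU SI S0 ST So cC cD sep.
have sepd d : D d ->
    exists A B, [/\ S A, S B, C `<=` A, B d & A `&` B = set0].
  move=> Dd; apply: (@compact_ind _ C
    (fun C => exists A B, [/\ S A, S B, C `<=` A, B d & A `&` B = set0])) => //.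
  - by exists set0, setT; split=> //; rewrite set0I.
  - move=> C1 C2 [A1 [B1 [SA1 SB1 C1A dB1 AB1]]] [A2 [B2 [SA2 SB2 C2A dB2 AB2]]].
    exists (A1 `|` A2), (B1 `&` B2); split; [exact: SU|exact: SI|exact: setUSS|by []|].
    apply/seteqP; split=> // x [[A1x|A2x] [B1x B2x]].
      by rewrite -AB1.
    by rewrite -AB2.
  - move=> C1 C2 C12 [A [B [SA SB CA dB AB]]]; exists A, B; split=> //.
    exact: subset_trans CA.
  - move=> c Cc; have [A [B [SA SB Ac Bd AB]]] := sep c d Cc Dd.
    exists A; first by apply: open_nbhs_nbhs; split=> //; exact: So.
    by exists A, B; split=> //; exact: subIsetr.
apply: (@compact_ind _ D
    (fun D => exists A B, [/\ S A, S B, C `<=` A, D `<=` B & A `&` B = set0])) => //.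
- by exists setT, set0; split=> //; rewrite setI0.
- move=> C1 C2 [A1 [B1 [SA1 SB1 C1A dB1 AB1]]] [A2 [B2 [SA2 SB2 C2A dB2 AB2]]].
  exists (A1 `&` A2), (B1 `|` B2); split; [exact: SI|exact: SU| |exact: setUSS|].
    by move=> x Cx; split; [exact: C1A|exact: C2A].
  apply/seteqP; split=> // x [[A1x A2x] [B1x|B2x]].
    by rewrite -AB1.
  by rewrite -AB2.
- move=> C1 C2 C12 [A [B [SA SB CA dB AB]]]; exists A, B; split=> //.
  exact: subset_trans dB.
- move=> d Dd; have [A [B [SA SB CA Bd AB]]] := sepd d Dd.
  exists B; first by apply: open_nbhs_nbhs; split=> //; exact: So.
  by exists A, B; split=> //; exact: subIsetr.
Qed.

Section Borel.
Variables (R : realType).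

Definition inner_regular (T : ptopologicalType)
    (mu : {measure set (borel T) -> \bar R}) :=
  forall A : set (borel T), measurable A ->
    mu A = ereal_sup [set mu C | C in [set C : set T | compact C /\ C `<=` A]].

Lemma open_borel (T : ptopologicalType) (A : set T) :
  open A -> measurable (A : set (borel T)).
Proof. by move=> oA; exact: sub_sigma_algebra. Qed.

Lemma closed_borel (T : ptopologicalType) (A : set T) :
  closed A -> measurable (A : set (borel T)).
Proof.
move=> cA; rewrite -(setCK A); apply: measurableC; apply: open_borel.
exact: closed_openC.
Qed.

Lemma compact_borel (T : ptopologicalType) (A : set T) :
  hausdorff_space T -> compact A -> measurable (A : set (borel T)).
Proof. by move=> hT cA; apply: closed_borel; exact: compact_closed. Qed.

Lemma continuous_borel (T T' : ptopologicalType) (f : T -> T') :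
  continuous f -> measurable_fun setT (f : borel T -> borel T').
Proof.
move=> cf; apply: (@measurability _ _ (borel T) (borel T') setT f (@open T')) => //.
move=> _ [A oA <-].
by rewrite setTI; apply: open_borel; exact: open_comp.
Qed.

Lemma inner_regular_compacts (T : ptopologicalType)
    (mu : {measure set (borel T) -> \bar R}) (A : set (borel T)) :
  hausdorff_space T -> inner_regular mu -> mu A < +oo -> measurable A ->
  exists C : nat -> set T, (forall n, compact (C n) /\ C n `<=` A) /\
    mu (A `\` \bigcup_n C n) = 0.
Proof.
move=> hT rmu finA mA.
have Afin : mu A \is a fin_num by rewrite ge0_fin_numE.
have approx n : exists C : set T, [/\ compact C, C `<=` A &
    mu (A `\` C) < (n.+1%:R^-1)%:E].
  have n0 : (0 < n.+1%:R^-1 :> R)%R by rewrite invr_gt0.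
  have := rmu A mA; move: Afin => /[swap] E; rewrite E.
  move=> /(ub_ereal_sup_adherent n0)[_ [C [cC CA] <-]]; rewrite -E => H.
  exists C; split=> //; have mC := compact_borel hT cC.
  rewrite measureD // (_ : A `&` C = C); last by apply/setIidPr.
  by rewrite lteBlDl ?ge0_fin_numE // ?(le_lt_trans _ finA) ?le_measure ?inE //
    -lteBlDr //.
pose C n := projT1 (cid (approx n)).
have CP n : [/\ compact (C n), C n `<=` A & mu (A `\` C n) < (n.+1%:R^-1)%:E].
  by rewrite /C; case: cid.
have mC n : measurable (C n : set (borel T)).
  by apply: compact_borel => //; case: (CP n).
exists C; split; first by move=> n; have [] := CP n.
apply/eqP; rewrite -measure_le0; apply/lee_addgt0Pr => e e0; rewrite add0e.
have [n ne] : exists n, (n.+1%:R^-1 < e)%R.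
  have := near_infty_natSinv_lt (PosNum e0); case=> n _ /(_ n (leqnn _)).
  by exists n.
apply: (@le_trans _ _ (mu (A `\` C n))).
  apply: le_measure; rewrite ?inE.
  - by apply: measurableD => //; exact: bigcupT_measurable.
  - exact: measurableD.
  - by apply: setDS; exact: bigcup_sup.
by have [_ _ /ltW/le_trans] := CP n; apply; rewrite lee_fin ltW.
Qed.

End Borel.

(** * Cylinders and the sigma-algebras they generate *)

Section Cylinders.
Variables (R : realType) (K : ptopologicalType).
Hypothesis hK : hausdorff_space K.
Implicit Types (A : nat -> set (borel K)) (J : set nat).

Lemma hausdorff_Kinf : hausdorff_space (Kinf K).
Proof. exact: (@hausdorff_product nat (fun=> K) (fun=> hK)). Qed.

Lemma coord_continuous i : continuous (fun k : Kinf K => k i : K).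
Proof. exact: (@proj_continuous nat (fun=> K) i). Qed.

Lemma Kinf_continuous (T : topologicalType) (f : T -> Kinf K) :
  (forall i, continuous (fun t => f t i : K)) -> continuous f.
Proof.
move=> cf t; apply/cvg_sup => i.
move: t; apply/(@continuousP _ (initial_topology (@^~ i))) => A [B oB <-].
by move/continuousP : (cf i) => /(_ B oB).
Qed.

Definition cylinder N A : set (Kinf K) := [set k | forall i, (i < N)%N -> A i (k i)].

(** A pi-system generating the product sigma-algebra of the coordinates in [J], which can be smaller
    than the class of Borel sets depending only on [J]. *)
Definition boxes J : set (set (Kinf K)) := [set B | exists N A,
  [/\ forall i, measurable (A i), forall i, ~ J i -> A i = setT & B = cylinder N A]].

Lemma cylinderS N A :
  cylinder N.+1 A = cylinder N A `&` (fun k : Kinf K => k N) @^-1` A N.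
Proof.
apply/seteqP; split=> [k H|k [H1 H2] i]; first by split=> [i iN|]; apply: H; lia.
by rewrite ltnS leq_eqVlt => /orP[/eqP->//|]; exact: H1.
Qed.

Lemma coord_measurable i : measurable_fun setT ((fun k => k i) : borel (Kinf K) -> borel K).
Proof. exact: (continuous_borel (@coord_continuous i)). Qed.

Lemma measurable_coord i (B : set (borel K)) : measurable B ->
  measurable ((fun k => k i) @^-1` B : set (borel (Kinf K))).
Proof. by move=> mB; rewrite -[_ @^-1` _]setTI; exact: coord_measurable. Qed.

Lemma measurable_cylinder N A : (forall i, measurable (A i)) ->
  measurable (cylinder N A : set (borel (Kinf K))).
Proof.
move=> mA; elim: N => [|N IHN]; last first.
  by rewrite cylinderS; apply: measurableI => //; exact: measurable_coord.
by rewrite (_ : cylinder 0 A = setT) //; apply/seteqP; split.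
Qed.

Lemma cylinder_le N N' A : (N <= N')%N ->
  cylinder N A = cylinder N' (fun i => if (i < N)%N then A i else setT).
Proof.
move=> NN'; apply/seteqP; split=> k H i iN; first by case: ifP => // /H.
by have := H i (leq_trans iN NN'); rewrite iN.
Qed.

Lemma setI_closed_boxes J : setI_closed (boxes J).
Proof.
move=> _ _ [N [A [mA JA ->]]] [N' [A' [mA' JA' ->]]].
pose B i := (if (i < N)%N then A i else setT) `&` (if (i < N')%N then A' i else setT).
exists (maxn N N'), B; split.
- by move=> i; apply: measurableI; case: ifP.
- by move=> i Ji; rewrite /B JA // JA' //; do 2 case: ifP; rewrite setTI.
apply/seteqP; split=> [k [H H'] i _|k H].
  by split; case: ifP => // iN; [exact: H|exact: H'].
by split=> i iN; have [] := H i (leq_trans iN _); rewrite ?leq_maxl ?leq_maxr ?iN.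
Qed.

Lemma boxes_borel J : boxes J `<=` (measurable : set (set (borel (Kinf K)))).
Proof. by move=> _ [N [A [mA _ ->]]]; exact: measurable_cylinder. Qed.

Lemma sigma_boxes_borel J : <<s boxes J >> `<=` (measurable : set (set (borel (Kinf K)))).
Proof.
apply: smallest_sub; [exact: sigma_algebra_measurable|exact: boxes_borel].
Qed.

Definition depends (B : set (Kinf K)) J :=
  forall k k' : Kinf K, (forall i, J i -> k i = k' i) -> B k -> B k'.

Lemma sigma_boxes_depends J B : <<s boxes J >> B -> depends B J.
Proof.
move: B; apply: smallest_sub.
  split=> [k k' _ []|B dB k k' kk' [_ nB]|F dF k k' kk' [n _ Fk]].
  - by split=> // B'; apply: nB; apply: dB B' => i Ji; rewrite kk'.
  - by exists n => //; exact: dF Fk.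
move=> _ [N [A [_ JA ->]]] k k' kk' H i iN.
have [Ji|nJi] := pselect (J i); first by rewrite -kk' //; exact: H.
by rewrite JA.
Qed.

Lemma sigma_boxes_coord J i (B : set (borel K)) : J i -> measurable B ->
  <<s boxes J >> ((fun k => k i) @^-1` B).
Proof.
move=> Ji mB; apply: sub_sigma_algebra.
exists i.+1, (fun j => if j == i then B else setT); split.
- by move=> j; case: ifP.
- by move=> j; case: eqVneq => [->//|].
apply/seteqP; split=> k H; first by move=> j _; case: eqVneq => [->|].
by have := H i (ltnSn i); rewrite eqxx.
Qed.

Lemma sep_compacts J (C D : set (Kinf K)) : compact C -> compact D ->
  (forall c d, C c -> D d -> exists2 i, J i & c i <> d i) ->
  exists B, [/\ <<s boxes J >> B, C `<=` B & D `<=` ~` B].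
Proof.
move=> cC cD CD.
pose S B := open B /\ <<s boxes J >> B.
pose sT := g_sigma_algebraType (boxes J).
have [] := @compact_separation (Kinf K) S C D.
- move=> A B [oA sA] [oB sB]; split; first exact: openU.
  exact: (@measurableU _ sT).
- move=> A B [oA sA] [oB sB]; split; first exact: openI.
  exact: (@measurableI _ sT).
- by split; [exact: open0|exact: (@measurable0 _ sT)].
- by split; [exact: openT|exact: (@measurableT _ sT)].
- by move=> A [].
- by [].
- by [].
- move=> c d Cc Dd; have [i Ji cd] := CD c d Cc Dd.
  have := hK; rewrite open_hausdorff => /(_ (c i) (d i)).
  move=> /(_ _)[|[A B] [/= cA dB] [oA oB AB]]; first by apply/eqP.
  exists ((fun k => k i) @^-1` A), ((fun k => k i) @^-1` B).
  have open_ V : open V -> open ((fun k : Kinf K => k i : K) @^-1` V).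
    by move=> oV; apply: open_comp => // x _; exact: coord_continuous.
  split.
  + by split; [exact: open_|apply: sigma_boxes_coord => //; exact: open_borel].
  + by split; [exact: open_|apply: sigma_boxes_coord => //; exact: open_borel].
  + by move: cA; rewrite inE.
  + by move: dB; rewrite inE.
  + by rewrite -preimage_setI (eqP AB) preimage_set0.
move=> A [B [[_ sA] _ CA DB AB]]; exists A; split=> // x Dx Ax.
have : (A `&` B) x by split=> //; exact: DB.
by rewrite AB.
Qed.

(* Compacts exhausting A and its complement up to null sets are separated by boxes
   with sides in J *)
Lemma borel_sigma_boxes J (mu nu : {measure set (borel (Kinf K)) -> \bar R})
    (A : set (borel (Kinf K))) :
  inner_regular mu -> inner_regular nu -> mu setT < +oo -> nu setT < +oo ->
  measurable A -> depends A J ->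
  exists B, [/\ <<s boxes J >> B, mu (A `\` B) = 0 & nu (B `\` A) = 0].
Proof.
move=> rmu rnu fmu fnu mA dA.
have fin (m : {measure set (borel (Kinf K)) -> \bar R}) B : m setT < +oo ->
    measurable B -> m B < +oo.
  by move=> + mB; apply: le_lt_trans; apply: le_measure; rewrite ?inE.
have [C [CA CE]] := inner_regular_compacts hausdorff_Kinf rmu (fin _ _ fmu mA) mA.
have mCA := measurableC mA.
have [D [DA DE]] := inner_regular_compacts hausdorff_Kinf rnu (fin _ _ fnu mCA) mCA.
(* As [A] depends only on [J], a point of [A] and a point outside it differ in some coordinate of
   [J]. *)
have sep n l : exists B, [/\ <<s boxes J >> B, C n `<=` B & D l `<=` ~` B].
  have [cC CnA] := CA n; have [cD DlA] := DA l.
  apply: sep_compacts => // c d Cc Dd; apply: contrapT => H.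
  apply: (DlA d Dd); apply: (dA c) => [i Ji|]; last exact: CnA.
  by apply: contrapT => cd; apply: H; exists i.
pose B n l := projT1 (cid (sep n l)).
have BP n l : [/\ <<s boxes J >> (B n l), C n `<=` B n l & D l `<=` ~` B n l].
  by rewrite /B; case: cid.
pose sT := g_sigma_algebraType (boxes J).
have sB : <<s boxes J >> (\bigcup_n \bigcap_l B n l).
  apply: (@bigcupT_measurable _ sT) => n; apply: (@bigcapT_measurable _ sT) => l.
  by have [] := BP n l.
have mB := sigma_boxes_borel sB.
have mC n : measurable (C n : set (borel (Kinf K))).
  by apply: compact_borel; [exact: hausdorff_Kinf|have [] := CA n].
have mD n : measurable (D n : set (borel (Kinf K))).
  by apply: compact_borel; [exact: hausdorff_Kinf|have [] := DA n].
exists (\bigcup_n \bigcap_l B n l); split=> //.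
  apply/eqP; rewrite -measure_le0 -CE; apply: le_measure; rewrite ?inE.
  - exact: measurableD.
  - by apply: measurableD => //; exact: bigcupT_measurable.
  - apply: setDS => k [n _ Ck]; exists n => // l _.
    by have [_ + _] := BP n l; exact.
apply/eqP; rewrite -measure_le0 -DE; apply: le_measure; rewrite ?inE.
- exact: measurableD.
- by apply: measurableD => //; exact: bigcupT_measurable.
- move=> k [[n _ Bk] nA]; split=> // -[l _ Dk].
  by have [_ _ /(_ k Dk)] := BP n l; apply; exact: Bk.
Qed.

(** On the sigma-algebra of the cylinders this is uniqueness on a pi-system. For a Borel set [B],
    [borel_sigma_boxes] with [J = setT] provides a set [S] of that sigma-algebra with
    [mu B <= mu S = nu S <= nu B]; the roles of [mu] and [nu] are then exchanged. *)
Lemma inner_regular_unique (mu nu : {measure set (borel (Kinf K)) -> \bar R}) :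
  inner_regular mu -> inner_regular nu -> mu setT = 1 -> nu setT = 1 ->
  (forall N A, (forall i, measurable (A i)) -> mu (cylinder N A) = nu (cylinder N A)) ->
  forall B, measurable B -> mu B = nu B.
Proof.
move=> rmu rnu mu1 nu1 munu.
have sE B : <<s boxes setT >> B -> mu B = nu B.
  apply: (@g_sigma_algebra_measure_unique _ R (borel (Kinf K)) (boxes setT) _ (fun=> setT)).
  - exact: boxes_borel.
  - move=> _; exists 0%N, (fun=> setT); split=> //.
    by apply/seteqP; split.
  - by apply/seteqP; split=> // k _; exists 0%N.
  - exact: setI_closed_boxes.
  - by move=> _ [N [A [mA _ ->]]]; exact: munu.
  - by move=> _; rewrite mu1 ltry.
have le_ (m m' : {measure set (borel (Kinf K)) -> \bar R}) B :
    inner_regular m -> inner_regular m' -> m setT = 1 -> m' setT = 1 ->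
    (forall B, <<s boxes setT >> B -> m B = m' B) -> measurable B -> m B <= m' B.
  move=> rm rm' m1 m'1 mm' mB.
  have [||//|S [sS mBS mSB]] := @borel_sigma_boxes setT m m' B rm rm' _ _ mB.
  - by rewrite m1 ltry.
  - by rewrite m'1 ltry.
  - by move=> k k' kk'; have -> : k = k' by apply/funext => i; exact: kk'.
  have mS := sigma_boxes_borel sS.
  have le2 (m0 : {measure set (borel (Kinf K)) -> \bar R}) X Y :
      measurable X -> measurable Y -> m0 (X `\` Y) = 0 -> m0 X <= m0 Y.
    move=> mX mY XY0; rewrite -[leRHS]adde0 -XY0.
    apply: (@le_trans _ _ (m0 (Y `|` (X `\` Y)))).
      apply: le_measure; rewrite ?inE //.
        by apply: measurableU => //; exact: measurableD.
      by move=> x Xx; have [Yx|] := pselect (Y x); [left|right].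
    by apply: measureU2 => //; exact: measurableD.
  by apply: (le_trans (le2 m _ _ mB mS mBS)); rewrite (mm' _ sS); exact: le2.
move=> B mB; apply/le_anti/andP; split; apply: le_ => //.
by move=> S sS; rewrite sE.
Qed.

End Cylinders.

(** * Invariance of the Haar measure *)

Lemma continuous_compT (T1 T2 T3 : topologicalType) (f : T1 -> T2) (g : T2 -> T3) :
  continuous f -> continuous g -> continuous (g \o f).
Proof. by move=> cf cg x; apply: continuous_comp; [exact: cf|exact: cg]. Qed.

Lemma continuousM (T : topologicalType) (K : topologicalGroupType) (f g : T -> K) :
  continuous f -> continuous g -> continuous (fun x => f x * g x)%g.
Proof.
move=> cf cg x; apply: (@continuous_comp _ _ _ (fun x => (f x, g x))
  (fun xy : K * K => xy.1 * xy.2)%g).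
  by apply: cvg_pair; [exact: cf|exact: cg].
exact: mulg_continuous.
Qed.

Lemma continuousI (T : topologicalType) (K : topologicalGroupType) (f : T -> K) :
  continuous f -> continuous (fun x => (f x)^-1)%g.
Proof.
by move=> cf; apply: (continuous_compT cf); exact: invg_continuous.
Qed.

Section Image.
Variables (R : realType) (T T' : ptopologicalType).
Variables (mu : probability (borel T) R) (f : T -> T').
Hypothesis (cf : continuous f).

Let mf := continuous_borel cf.
Let F : {mfun borel T >-> borel T'} :=
  HB.pack (f : borel T -> borel T') (@isMeasurableFun.Build _ _ _ _ _ mf).

Definition image_probability : probability (borel T') R := distribution mu F.

Lemma image_probabilityE B : image_probability B = mu (f @^-1` B).
Proof. by []. Qed.

Lemma image_regular : hausdorff_space T -> hausdorff_space T' ->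
  inner_regular mu -> inner_regular image_probability.
Proof.
move=> hT hT' rmu A mA; rewrite -[LHS]/(mu (f @^-1` A)).
have mfA : measurable (f @^-1` A : set (borel T)).
  by rewrite -[X in measurable X]setTI; exact: mf.
rewrite rmu //; apply/le_anti/andP; split.
  apply: ub_ereal_sup => _ [C [cC CA] <-].
  have cfC : compact (f @` C).
    by apply: continuous_compact => //; exact: continuous_subspaceT.
  apply: (@le_trans _ _ (mu (f @^-1` (f @` C)))).
    apply: le_measure; rewrite ?inE; first exact: compact_borel.
      by rewrite -[X in measurable X]setTI; apply: mf => //; exact: compact_borel.
    by move=> x Cx; exists x.
  apply: ereal_sup_ubound; exists (f @` C) => //; split=> // _ [x Cx <-].
  exact: CA.
apply: ub_ereal_sup => _ [C [cC CA] <-]; rewrite -rmu // -[leLHS]/(mu (f @^-1` C)).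
apply: le_measure; rewrite ?inE //.
  by rewrite -[X in measurable X]setTI; apply: mf => //; exact: compact_borel.
by move=> x Cx; exact: CA.
Qed.

End Image.

Section Preserving.
Variables (R : realType) (K : topologicalGroupType).
Hypotheses (cK : compact [set: K]) (hK : hausdorff_space K).
Variables (lambda : probability (borel K) R) (mu : probability (borel (Kinf K)) R).
Hypotheses (Hlambda : haar_probability lambda) (Hmu : product_probability lambda mu).
Implicit Types (A : nat -> set (borel K)) (phi : Kinf K -> Kinf K).

(** Continuity keeps composites with Borel functions Borel and image measures inner regular. *)
Definition preserving phi := continuous phi /\
  forall B : set (borel (Kinf K)), measurable B -> mu (phi @^-1` B) = mu B.

Lemma lambda_mull (a : K) (B : set (borel K)) : measurable B ->
  lambda ((fun x : K => (a * x)%g) @^-1` B) = lambda B.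
Proof. by case: Hlambda => _; exact. Qed.

Lemma mu_cylinder N A : (forall i, measurable (A i)) ->
  mu (cylinder N A) = \prod_(i < N) lambda (A i).
Proof. by move=> mA; have [_] := Hmu; exact. Qed.

(** The image measure is again inner regular, hence determined by its values on cylinders. *)
Lemma preserving_cylinder phi : continuous phi ->
  (forall N A, (forall i, measurable (A i)) ->
     mu (phi @^-1` cylinder N A) = \prod_(i < N) lambda (A i)) ->
  preserving phi.
Proof.
move=> cphi H; split=> // B mB; rewrite -(image_probabilityE mu cphi).
have rmu : inner_regular mu by have [] := Hmu.
apply: (@inner_regular_unique R K hK (image_probability mu cphi) mu) => //.
- by apply: image_regular => //; exact: hausdorff_Kinf.
- exact: probability_setT.
- exact: probability_setT.
- by move=> N A mA; rewrite -[LHS]/(mu (phi @^-1` cylinder N A)) H // -mu_cylinder.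
Qed.

Lemma preserving_id : preserving idfun.
Proof. by split=> // x. Qed.

Lemma preserving_measurable phi (B : set (borel (Kinf K))) : preserving phi ->
  measurable B -> measurable (phi @^-1` B : set (borel (Kinf K))).
Proof.
by move=> [c _] mB; rewrite -[X in measurable X]setTI; exact: (continuous_borel c).
Qed.

Lemma preserving_comp phi psi : preserving phi -> preserving psi ->
  preserving (phi \o psi).
Proof.
move=> pphi ppsi; have [c1 m1] := pphi; have [c2 m2] := ppsi; split.
  exact: continuous_compT.
by move=> B mB; rewrite comp_preimage m2 ?m1 //; exact: preserving_measurable.
Qed.

Lemma preserving_inv phi psi : preserving phi -> continuous psi ->
  cancel phi psi -> preserving psi.
Proof.
move=> [c m] cpsi phiK; split=> // B mB; rewrite -m; last first.
  by rewrite -[X in measurable X]setTI; exact: (continuous_borel cpsi).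
by congr (mu _); apply/funext => k; rewrite /preimage /= phiK.
Qed.

Lemma preserving_coordwise (f : nat -> K -> K) : (forall i, continuous (f i)) ->
  (forall i (B : set (borel K)), measurable B -> lambda (f i @^-1` B) = lambda B) ->
  preserving (fun k i => f i (k i)).
Proof.
move=> cf lf; apply: preserving_cylinder.
  apply: Kinf_continuous => i; apply: (continuous_compT (@coord_continuous K i)).
  exact: cf.
move=> N A mA.
transitivity (mu (cylinder N (fun i => f i @^-1` A i))); first by [].
rewrite mu_cylinder; first by apply: eq_bigr => i _; rewrite lf.
by move=> i; rewrite -[X in measurable X]setTI; exact: (continuous_borel (cf i)).
Qed.

Lemma preserving_reindex n (s t : nat -> nat) : cancel s t -> cancel t s ->
  (forall i, (i < n)%N -> (s i < n)%N) -> (forall i, (n <= i)%N -> s i = i) ->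
  preserving (fun k i => k (s i)).
Proof.
move=> sK tK sn sfix; apply: preserving_cylinder.
  by apply: Kinf_continuous => i; exact: coord_continuous.
move=> N A mA; rewrite -mu_cylinder //.
(* Padding with [setT] up to [M] makes the range of constrained coordinates stable under [s] and
   [t]. *)
pose M := maxn N n; pose A' i := if (i < N)%N then A i else setT.
have -> : cylinder N A = cylinder M A' by apply: cylinder_le; exact: leq_maxl.
have mA' i : measurable (A' i) by rewrite /A'; case: ifP.
have sM i : (i < M)%N -> (s i < M)%N.
  move=> iM; case: (ltnP i n) => [/sn si|/sfix->//].
  by rewrite (leq_trans si) // leq_maxr.
have tM i : (i < M)%N -> (t i < M)%N.
  move=> iM; rewrite ltnNge; apply/negP => Mt; have := tK i.
  by rewrite sfix => [E|]; [lia|rewrite (leq_trans _ Mt) // leq_maxr].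
transitivity (mu (cylinder M (fun i => A' (t i)))).
  congr (mu _); apply/seteqP; split=> k H i iM /=.
    by have := H (t i) (tM _ iM); rewrite /= tK.
  by have := H (s i) (sM _ iM); rewrite sK.
rewrite !mu_cylinder // (reindex (fun i : 'I_M => Ordinal (sM i (ltn_ord i)))) /=.
  by apply: eq_bigr => i _; rewrite sK.
exists (fun i : 'I_M => Ordinal (tM i (ltn_ord i))) => i _; apply: val_inj => /=.
  by rewrite sK.
by rewrite tK.
Qed.

Section Transvection.
Variables (i j : nat).
Hypothesis ij : i != j.
Variable Z : set (borel (Kinf K)).
Hypothesis mZ : measurable Z.
Hypothesis indep : forall V Q : set (borel K), measurable V -> measurable Q ->
  mu [set k : Kinf K | V (k i) /\ Q (k j) /\ Z k] = lambda V * lambda Q * mu Z.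

Let E (B Q : set (borel K)) : set (borel (Kinf K)) :=
  [set k : Kinf K | B (k j * k i)%g /\ Q (k j) /\ Z k].

Let mul_cont : continuous (fun k : Kinf K => (k j * k i)%g : K).
Proof. by apply: continuousM; exact: coord_continuous. Qed.

Let mE (B Q : set (borel K)) : measurable B -> measurable Q -> measurable (E B Q).
Proof.
move=> mB mQ; apply: measurableI.
  by rewrite -[X in measurable X]setTI; exact: (continuous_borel mul_cont).
by apply: measurableI => //; exact: measurable_coord.
Qed.

Let mI (V Q : set (borel K)) : measurable V -> measurable Q ->
  measurable ([set k : Kinf K | V (k i) /\ Q (k j) /\ Z k] : set (borel (Kinf K))).
Proof.
move=> mV mQ; apply: measurableI; first exact: measurable_coord.
by apply: measurableI => //; exact: measurable_coord.
Qed.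

Let fin (B : set (borel K)) : measurable B -> lambda B \is a fin_num.
Proof. by move=> mB; exact: fin_num_measure. Qed.

(* Fubini does not apply: as K need not be second countable, k j * k i need not be
   measurable for the product sigma-algebra. Instead, cover K by open sets on which
   left translation by k j is uniformly close to a fixed translation. *)
Let transv_open (C V : set K) : compact C -> open V -> C `<=` V ->
  forall Q, measurable Q -> mu (E C Q) <= lambda V * lambda Q * mu Z.
Proof.
move=> cC oV CV.
have mC : measurable (C : set (borel K)) by exact: compact_borel.
have mV : measurable (V : set (borel K)) by exact: open_borel.
(* This form is stable under unions: [Q] is cut along [W1], the left side of the bound being
   subadditive in [Q] and the right side additive. *)
pose good (S : set K) := exists W' : set (borel K), [/\ measurable W', S `<=` W' &
  forall Q, measurable Q -> Q `<=` W' -> mu (E C Q) <= lambda V * lambda Q * mu Z].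
suff [W' [mW' OT H]] : good setT.
  by move=> Q mQ; apply: H => // x _; exact: OT.
apply: (@compact_ind _ [set: K]) => //.
- exists set0; split=> // Q mQ +; rewrite subset0 => ->; rewrite (_ : E C set0 = set0).
    by rewrite !measure0 mule0 mul0e.
  by apply/seteqP; split=> // k [_ []].
- move=> S1 S2 [W1 [m1 S1O H1]] [W2 [m2 S2O H2]].
  exists (W1 `|` W2); split; [exact: measurableU|exact: setUSS|].
  move=> Q mQ QO; have mQ1 : measurable (Q `&` W1) by exact: measurableI.
  have mQ2 : measurable (Q `\` W1) by exact: measurableD.
  have -> : lambda Q = lambda (Q `&` W1) + lambda (Q `\` W1).
    by rewrite addeC; exact: (measureDI lambda mQ m1).
  rewrite ge0_muleDr // ge0_muleDl ?mule_ge0 //.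
  apply: (@le_trans _ _ (mu (E C (Q `&` W1)) + mu (E C (Q `\` W1)))).
    apply: (@le_trans _ _ (mu (E C (Q `&` W1) `|` E C (Q `\` W1)))).
      apply: le_measure; rewrite ?inE; [exact: mE| |].
        by apply: measurableU; exact: mE.
      move=> k [Ck [Qk Zk]]; have [w1|w1] := pselect (W1 (k j)); [left|right];
        by split.
    by apply: measureU2; exact: mE.
  apply: leeD; first by apply: H1 => // x [].
  by apply: H2 => // x [Qx nO1]; have [] := QO x Qx.
- move=> S1 S2 S12 [W' [mW' SO H]]; exists W'; split=> //.
  exact: subset_trans SO.
move=> b _.
(* Tube lemma: for [y] near [b], [b * y^-1 * a] lies in [V] for all [a] in [C]. With [y = k j] and
   [a = k j * k i] this places [b * k i] in [V], and left invariance removes the factor [b]. *)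
have /compact_near_coveringP ncC := cC.
pose f (ay : K * K) := (b * ay.2^-1 * ay.1)%g.
have cf : continuous f.
  apply: continuousM; last by move=> z; exact: cvg_fst.
  apply: continuousM; first by move=> z; exact: cvg_cst.
  by apply: continuousI => z; exact: cvg_snd.
have nC a : C a -> \forall a' \near a & y \near nbhs b, V (f (a', y)).
  move=> Ca; apply: (cf (a, b)); rewrite /f /= mulgV mul1g.
  by apply: open_nbhs_nbhs; split=> //; exact: CV.
have := ncC K (nbhs b) (fun y a => V (f (a, y))) (nbhs_filter b) nC.
move=> nW; have [W1 [oW1 bW1] H] :
    exists2 W, open_nbhs b W & W `<=` (fun y => C `<=` (fun a => V (f (a, y)))).
  by move: nW; rewrite nbhsE.
exists W1; first by apply: open_nbhs_nbhs; split.
exists W1; split; [exact: open_borel|by move=> x []|]; move=> Q mQ QO.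
pose V' := (fun x => (b * x)%g) @^-1` V.
have mV' : measurable (V' : set (borel K)).
  apply: open_borel; apply: open_comp => // x _.
  by apply: continuousM => z; [exact: cvg_cst|exact: cvg_id].
rewrite -(lambda_mull b mV) -indep //; apply: le_measure; rewrite ?inE.
- exact: mE.
- exact: mI.
move=> k [Ck [Qk Zk]]; split=> //.
have := H (k j) (QO _ Qk) _ Ck.
by rewrite /f /= mulgA -[(b * _^-1 * _)%g]mulgA mulVg mulg1.
Qed.

(** Outer regularity at [C]: a compact [D] nearly filling the complement of [C] has an open
    complement barely larger than [C]. *)
Let transv_compact (C : set K) : compact C ->
  forall Q, measurable Q -> mu (E C Q) <= lambda C * lambda Q * mu Z.
Proof.
move=> cC Q mQ; have mC : measurable (C : set (borel K)) by exact: compact_borel.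
apply/lee_addgt0Pr => e e0.
have [D [cD DC DE]] : exists D : set K, [/\ compact D, D `<=` ~` C &
    lambda (~` C) - e%:E < lambda D].
  have [rl _] := Hlambda; have mC' := measurableC mC.
  have := fin mC'; rewrite {1}(rl _ mC') => /(ub_ereal_sup_adherent e0).
  by rewrite -(rl _ mC') => -[_ [D [cD DC] <-] ?]; exists D.
have mD : measurable (D : set (borel K)) by exact: compact_borel.
have oD : open (~` D) by apply: closed_openC; exact: compact_closed.
have CD : C `<=` ~` D by move=> x Cx Dx; exact: DC Dx Cx.
apply: (le_trans (transv_open cC oD CD mQ)).
have lD : lambda (~` D) <= lambda C + e%:E.
  move: DE; rewrite !probability_setC //.
  rewrite -(fineK (fin mC)) -(fineK (fin mD)) -!EFinB -EFinD lte_fin lee_fin; lra.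
have Qfin := fin mQ.
have lQ1 : lambda Q * mu Z <= 1.
  rewrite -[1]mule1; apply: lee_pmul => //; exact: probability_le1.
rewrite -!muleA; apply: (@le_trans _ _ ((lambda C + e%:E) * (lambda Q * mu Z))).
  by apply: lee_wpmul2r => //; exact: mule_ge0.
rewrite ge0_muleDl ?lee_fin ?(ltW e0) //; apply: leeD2l.
rewrite -[leRHS]mule1; apply: lee_wpmul2l => //; by rewrite lee_fin ltW.
Qed.

(** By inner regularity of [mu] it is enough to bound compacts inside [E B Q], and the products
    [k j * k i] over such a compact form a compact inside [B]. *)
Let transv_le (B Q : set (borel K)) : measurable B -> measurable Q ->
  mu (E B Q) <= lambda B * lambda Q * mu Z.
Proof.
move=> mB mQ; have [rmu _] := Hmu; rewrite rmu; last exact: mE.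
apply: ub_ereal_sup => _ [D [cD DE] <-].
pose C := (fun k : Kinf K => (k j * k i)%g : K) @` D.
have cC : compact C.
  by apply: continuous_compact => //; exact: continuous_subspaceT.
have mC : measurable (C : set (borel K)) by exact: compact_borel.
apply: (@le_trans _ _ (mu (E C Q))).
  apply: le_measure; rewrite ?inE; [|exact: mE|].
    by apply: compact_borel => //; exact: hausdorff_Kinf.
  by move=> k Dk; have [_ QZ] := DE k Dk; split=> //; exists k.
apply: (le_trans (transv_compact cC mQ)); rewrite -!muleA.
apply: lee_wpmul2r; first exact: mule_ge0.
apply: le_measure; rewrite ?inE //.
by move=> _ [k Dk <-]; have [] := DE k Dk.
Qed.

(** The upper bounds for [B] and for its complement have the sum [lambda Q * mu Z], which is also
    the sum of the two measures; so neither bound is strict. *)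
Lemma transv_indep (B Q : set (borel K)) : measurable B -> measurable Q ->
  mu [set k : Kinf K | B (k j * k i)%g /\ Q (k j) /\ Z k] =
  lambda B * lambda Q * mu Z.
Proof.
move=> mB mQ; apply/le_anti/andP; split; first exact: transv_le.
have mB' := measurableC mB.
have EU : E B Q `|` E (~` B) Q = [set k : Kinf K | setT (k i) /\ Q (k j) /\ Z k].
  apply/seteqP; split=> [k [[_ H]|[_ H]]|k [_ H]] //.
  by have [Bk|Bk] := pselect (B (k j * k i)%g); [left|right].
have := @indep setT Q measurableT mQ; rewrite -EU measureU; last first.
- by apply/seteqP; split=> // k [[? _] [? _]].
- exact: mE.
- exact: mE.
rewrite probability_setT mul1e => EE0.
have EE : mu (E B Q) + mu (E (~` B) Q) = lambda Q * mu Z := EE0.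
have := transv_le mB' mQ; rewrite probability_setC //.
have fE S : measurable S -> mu S \is a fin_num by move=> mS; exact: fin_num_measure.
move: EE; rewrite -/(E B Q) -(fineK (fE _ (mE mB mQ))) -(fineK (fE _ (mE mB' mQ))).
rewrite -(fineK (fin mB)) -(fineK (fin mQ)) -(fineK (fE _ mZ)).
rewrite -EFinB -!EFinM -EFinD => [EE]; rewrite !lee_fin.
move: EE; move: (fine _) (fine _) (fine _) (fine _) (fine _) => a b c d e [+] + ; nra.
Qed.

End Transvection.

End Preserving.

Lemma continuous_fg_lift (T : topologicalType) (K : topologicalGroupType)
    (f : T -> nat -> K) (w : Finf) :
  (forall i, continuous (f ^~ i)) -> continuous (fun t => fg_lift (f t) w).
Proof.
move=> cf; rewrite /fg_lift; elim: (fg_val w) => /= [|a u IHu].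
  by move=> t; exact: cvg_cst.
apply: continuousM => //; rewrite /letter_val; case: a.2; first exact: cf.
by apply: continuousI; exact: cf.
Qed.

Lemma act_continuous (K : topologicalGroupType) g : continuous (@act K g).
Proof.
apply: Kinf_continuous => i; apply: continuous_fg_lift => j.
exact: coord_continuous.
Qed.

(** The order is reversed here and once more in [Trep], which is therefore a homomorphism. *)
Lemma act_comp (K : groupType) g h : monoid.monoid_morphism g ->
  @act K (g \o h) = @act K h \o @act K g.
Proof.
move=> gM; apply/funext => k; apply/funext => i; rewrite /act /=.
have -> : fg_lift (fun j => fg_lift k (g (xgen j))) = fg_lift k \o g.
  apply/esym/morphism_ext; last by move=> j; rewrite /= /xgen fg_lift_gen.
    have [g1 gM2] := gM; have [l1 lM] := fg_lift_morphism k.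
    by split=> [|x y] /=; rewrite ?g1 ?l1 // gM2 lM.
  exact: fg_lift_morphism.
by [].
Qed.

Lemma act_id (K : groupType) : @act K idfun = idfun.
Proof. by apply/funext => k; apply/funext => i; rewrite /act /xgen fg_lift_gen. Qed.

Lemma act_can (K : groupType) g g' : monoid.monoid_morphism g' ->
  cancel g g' -> cancel (@act K g') (@act K g).
Proof.
move=> g'M gK k; rewrite -[LHS]/((act g \o act g') k) -act_comp //.
by rewrite (_ : g' \o g = idfun) ?act_id //; exact/funext.
Qed.

Section HaarPreserving.
Variables (R : realType) (K : topologicalGroupType).
Hypotheses (cK : compact [set: K]) (hK : hausdorff_space K).
Variables (lambda : probability (borel K) R) (mu : probability (borel (Kinf K)) R).
Hypotheses (Hlambda : haar_probability lambda) (Hmu : product_probability lambda mu).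
Implicit Types (A : nat -> set (borel K)) (phi : Kinf K -> Kinf K).

Definition left_transv (i j : nat) (k : Kinf K) : Kinf K :=
  fun l => if l == i then (k j * k i)%g else k l.

(** This is [transv_indep] with [Z] the conditions that a cylinder puts on the coordinates other
    than [i] and [j]. *)
Lemma left_transv_preserving i j : i != j -> preserving mu (left_transv i j).
Proof.
move=> ij; apply: (preserving_cylinder hK Hmu).
  apply: Kinf_continuous => l; rewrite /left_transv.
  case: (l == i); last exact: coord_continuous.
  by apply: continuousM; exact: coord_continuous.
move=> N A mA; rewrite -(mu_cylinder Hmu) //.
pose M := (N + i + j).+1; pose A' l := if (l < N)%N then A l else setT.
have -> : cylinder N A = cylinder M A' by apply: cylinder_le; rewrite /M; lia.
have mA' l : measurable (A' l) by rewrite /A'; case: ifP.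
have iM : (i < M)%N by rewrite /M; lia.
have jM : (j < M)%N by rewrite /M; lia.
pose B (V Q : set (borel K)) (l : nat) :=
  if l == i then V else if l == j then Q else A' l : set (borel K).
have mB V Q : measurable V -> measurable Q -> forall l, measurable (B V Q l).
  by move=> mV mQ l; rewrite /B; case: ifP => // _; case: ifP.
pose Z := cylinder M (B setT setT).
have cylE V Q : cylinder M (B V Q) = [set k : Kinf K | V (k i) /\ Q (k j) /\ Z k].
  apply/seteqP; split=> [k H|k [Vk [Qk Zk]] l lM].
    split; first by have := H i iM; rewrite /B eqxx.
    split; first by have := H j jM; rewrite /B eq_sym (negbTE ij) eqxx.
    move=> l lM; rewrite /B; case: eqP => // /eqP li; case: eqP => // /eqP lj.
    by have := H l lM; rewrite /B (negbTE li) (negbTE lj).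
  rewrite /B; case: eqVneq => [->//|li]; case: eqVneq => [->//|lj].
  by have := Zk l lM; rewrite /B (negbTE li) (negbTE lj).
have prodE V Q : measurable V -> measurable Q ->
    mu (cylinder M (B V Q)) = lambda V * lambda Q * mu Z.
  move=> mV mQ; rewrite /Z !(mu_cylinder Hmu); [|exact: mB|exact: mB].
  rewrite (bigD1 (Ordinal iM)) //= (bigD1 (Ordinal jM)) /=; last first.
    by rewrite -val_eqE /= eq_sym.
  rewrite [in RHS](bigD1 (Ordinal iM)) //= [in RHS](bigD1 (Ordinal jM)) /=; last first.
    by rewrite -val_eqE /= eq_sym.
  rewrite /B eqxx [j == i]eq_sym (negbTE ij) eqxx !probability_setT !mul1e muleA.
  congr (_ * _); apply: eq_bigr => l /andP[li lj].
  by rewrite -!val_eqE /= in li lj; rewrite (negbTE li) (negbTE lj).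
have mZ : measurable (Z : set (borel (Kinf K))) by apply: measurable_cylinder; exact: mB.
have indep (V Q : set (borel K)) : measurable V -> measurable Q ->
    mu [set k : Kinf K | V (k i) /\ Q (k j) /\ Z k] = lambda V * lambda Q * mu Z.
  by move=> mV mQ; rewrite -cylE prodE.
have A'E : B (A' i) (A' j) = A'.
  by apply/funext => l; rewrite /B; case: eqVneq => [->//|_]; case: eqVneq => [->|].
rewrite -{2}A'E prodE // -(transv_indep cK hK Hlambda Hmu mZ indep) //.
congr (mu _); apply/seteqP; split=> [k H|k [Vk [Qk Zk]] l lM].
  split; first by have := H i iM; rewrite /left_transv eqxx.
  split; first by have := H j jM; rewrite /left_transv eq_sym (negbTE ij).
  move=> l lM; rewrite /B; case: eqP => // /eqP li; case: eqP => // /eqP lj.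
  by have := H l lM; rewrite /left_transv (negbTE li).
rewrite /left_transv; case: eqVneq => [->//|li]; have [->//|lj] := eqVneq l j.
by have := Zk l lM; rewrite /B (negbTE li) (negbTE lj).
Qed.

Let coord_law i (B : set (borel K)) : measurable B ->
  mu [set k : Kinf K | B (k i)] = lambda B.
Proof.
move=> mB; pose A l := if l == i then B else setT : set (borel K).
have mA l : measurable (A l) by rewrite /A; case: ifP.
have -> : [set k : Kinf K | B (k i)] = cylinder i.+1 A.
  apply/seteqP; split=> k H; first by move=> l _; rewrite /A; case: eqVneq => [->|].
  by have := H i (ltnSn i); rewrite /A eqxx.
rewrite (mu_cylinder Hmu) // (bigD1 ord_max) //= /A eqxx big1 ?mule1 // => l li.
by rewrite -val_eqE /= in li; rewrite (negbTE li) probability_setT.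
Qed.

(* (k 0)^-1 * k 1 and its inverse (k 1)^-1 * k 0 are both Haar distributed *)
Lemma haar_inv (B : set (borel K)) : measurable B ->
  lambda ((fun x : K => (x^-1)%g) @^-1` B) = lambda B.
Proof.
have cI : continuous (fun x : K => (x^-1)%g) by exact: invg_continuous.
move=> mB; pose B' := (fun x : K => (x^-1)%g) @^-1` B.
have mB' : measurable (B' : set (borel K)).
  by rewrite -[X in measurable X]setTI; exact: (continuous_borel cI).
pose tr (i j : nat) (k : Kinf K) : Kinf K := fun l => if l == i then ((k j)^-1 * k i)%g else k l.
have ptr (i j : nat) : i != j -> preserving mu (tr i j).
  move=> ij; apply: preserving_inv (left_transv_preserving ij) _ _.
    apply: Kinf_continuous => l; rewrite /tr; case: (l == i); last exact: coord_continuous.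
    by apply: continuousM; [apply: continuousI|]; exact: coord_continuous.
  move=> k; apply/funext => l; rewrite /tr /left_transv eqxx [j == i]eq_sym (negbTE ij).
  by case: eqVneq => [->|//]; rewrite mulgA mulVg mul1g.
have mc i (S : set (borel K)) : measurable S ->
    measurable ([set k : Kinf K | S (k i)] : set (borel (Kinf K))).
  exact: measurable_coord.
have [_ p01] := @ptr 0%N 1%N isT; have [_ p10] := @ptr 1%N 0%N isT.
rewrite -(coord_law 0%N mB) -(p01 _ (mc 0%N _ mB)).
rewrite -(coord_law 1%N mB') -(p10 _ (mc 1%N _ mB')).
congr (mu _); apply/funext => k.
by rewrite /preimage /= /tr /B' /preimage /= invgM invgK.
Qed.

(** Inversion turns right translation by [a] into left translation by its inverse. *)
Lemma haar_mulr (a : K) (B : set (borel K)) : measurable B ->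
  lambda ((fun x : K => (x * a)%g) @^-1` B) = lambda B.
Proof.
move=> mB.
have cI : continuous (fun x : K => (x^-1)%g) by exact: invg_continuous.
have cR : continuous (fun x : K => (x * a)%g).
  by apply: continuousM => x; [exact: cvg_id|exact: cvg_cst].
have mI (S : set (borel K)) : measurable S ->
    measurable ((fun x : K => (x^-1)%g) @^-1` S : set (borel K)).
  by move=> mS; rewrite -[X in measurable X]setTI; exact: (continuous_borel cI).
have mBa : measurable ((fun x : K => (x * a)%g) @^-1` B : set (borel K)).
  by rewrite -[X in measurable X]setTI; exact: (continuous_borel cR).
rewrite -haar_inv // -[RHS]haar_inv // -[RHS](lambda_mull Hlambda (a^-1)%g); last exact: mI.
by congr (lambda _); apply/funext => x; rewrite /preimage /= invgM invgK.
Qed.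

Lemma conj_act_preserving u : preserving mu (@conj_act K u).
Proof.
apply: (preserving_coordwise hK Hmu (f := fun _ x => (u * x * u^-1)%g)).
  move=> _; apply: continuousM => [|x]; last exact: cvg_cst.
  by apply: continuousM => x; [exact: cvg_cst|exact: cvg_id].
move=> _ B mB; rewrite -(haar_mulr (u^-1)%g mB) -[RHS](lambda_mull Hlambda u) //.
have cR : continuous (fun x : K => (x * u^-1)%g).
  by apply: continuousM => x; [exact: cvg_id|exact: cvg_cst].
by rewrite -[X in measurable X]setTI; exact: (continuous_borel cR).
Qed.

Lemma inv_coords_preserving (s : pred nat) :
  preserving mu (fun (k : Kinf K) i => if s i then ((k i)^-1)%g else k i).
Proof.
apply: (preserving_coordwise hK Hmu (f := fun i x => if s i then (x^-1)%g else x)).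
  by move=> i; case: (s i); [exact: invg_continuous|move=> x].
by move=> i B mB; case: (s i) => //; exact: haar_inv.
Qed.

Lemma act_transv_preserving a b : a.1 != b.1 -> preserving mu (@act K (transv a b)).
Proof.
move=> ab.
(* The involution [S] inverts the coordinates at which [a] or [b] is a negative letter; conjugation
   by it reduces to the case of two positive letters. *)
pose s i := (i == a.1) && ~~ a.2 || (i == b.1) && ~~ b.2.
pose S (k : Kinf K) : Kinf K := fun i => if s i then ((k i)^-1)%g else k i.
have -> : @act K (transv a b) = S \o (left_transv b.1 a.1 \o S).
  apply/funext => k; apply/funext => i; rewrite /act /= -/(lett (i, true)).
  have sa : s a.1 = ~~ a.2 by rewrite /s eqxx (negbTE ab) orbF.
  have sb : s b.1 = ~~ b.2 by rewrite /s eqxx eq_sym (negbTE ab).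
  rewrite /S /left_transv sa sb; have [->|ib] := eqVneq i b.1.
    rewrite /transv fg_lift_lett /letter_val /= eqxx sb.
    have [_ lM] := fg_lift_morphism k.
    case: ifP => b2.
      by rewrite lM !fg_lift_lett /letter_val b2 /=; case: a.2.
    rewrite (morphismV _ (fg_lift_morphism k)) lM !fg_lift_lett /letter_val b2 /=.
    by case: a.2.
  rewrite transv_lett //.
  have -> : ((i, true) == b) = false.
    by apply: contraNF ib => /eqP <-.
  have -> : ((i, true) == linv b) = false.
    by apply: contraNF ib => /eqP E; rewrite -[b.1]/((linv b).1) -E.
  by rewrite fg_lift_lett /letter_val /=; case: (s i); rewrite ?invgK.
apply: preserving_comp; first exact: inv_coords_preserving.
apply: preserving_comp; last exact: inv_coords_preserving.
by apply: left_transv_preserving; rewrite eq_sym.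
Qed.

Lemma act_preserving g : GG g -> preserving mu (@act K g).
Proof.
move: g; apply: nielsen_ind => [n g g' ag signed|g a b ab gM pg]; last first.
  have -> : @act K g = @act K (transv (linv a) b) \o @act K (g \o transv a b).
    have tK : cancel (transv (linv a) b) (transv a b).
      by move=> x; rewrite -{1}(linvK a) transvK.
    apply/funext => k; rewrite (act_comp K (transv a b) gM) /=.
    by rewrite (act_can (transv_morphism a b) tK).
  apply: preserving_comp => //; apply: act_transv_preserving; exact: ab.
have [gM g'M gK g'K Hg] := ag.
suff pg' : preserving mu (@act K g').
  apply: (preserving_inv pg'); [exact: act_continuous|exact: act_can].
pose l i := projT1 (cid (signed i)).
have lE i : g' (xgen i) = lett (l i) by rewrite /l; case: cid.
pose s i := (l i).1.
have gs i : g (xgen (s i)) = if (l i).2 then xgen i else (xgen i)^-1%g.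
  have := congr1 g (lE i); rewrite g'K lett_letter_val /letter_val -/(s i).
  by case: (l i).2 => [->//|->]; rewrite morphismV // invgK.
have s_fix i : (n <= i)%N -> s i = i.
  move=> ni; have := Hg i; rewrite ltnNge ni /= => gi.
  have := lE i; rewrite -{1}gi gK => /(congr1 (@fg_val nat)) [E].
  by rewrite /s -E.
have s_lt i : (i < n)%N -> (s i < n)%N.
  move=> i_n; have := Hg i; rewrite i_n => -[_].
  by rewrite lE /Fsub /= andbT.
have s_inj : injective s.
  move=> i j sij; have := gs i; rewrite sij gs.
  by case: (l i).2; case: (l j).2 => /(congr1 (@fg_val nat)) [].
pose so (i : 'I_n) : 'I_n := Ordinal (s_lt i (ltn_ord i)).
have so_inj : injective so by move=> i j /(congr1 val) /s_inj /val_inj.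
(* The inverse of [s]: below [n] it exists because [s] is injective on a finite set, and from [n] on
   [s] is the identity. *)
pose t j := if insub j is Some o then val (invF so_inj o) else j.
have sK : cancel s t.
  move=> i; rewrite /t; case: insubP => [w _ wE|].
    have [i_n|ni] := ltnP i n; last first.
      by have := ltn_ord w; rewrite wE s_fix // ltnNge ni.
    rewrite (_ : w = so (Ordinal i_n)) ?invF_f //; exact: val_inj.
  by rewrite -leqNgt => ni; apply: s_inj; rewrite s_fix.
have tK : cancel t s.
  move=> j; rewrite /t; case: insubP => [w _ <-|]; last by rewrite -leqNgt; exact: s_fix.
  by rewrite -[RHS](congr1 val (f_invF so_inj w)).
have -> : @act K g' = (fun k i => if ~~ (l i).2 then ((k i)^-1)%g else k i) \o
    (fun k i => k (s i)).
  apply/funext => k; apply/funext => i.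
  by rewrite /act lE fg_lift_lett /letter_val /= -/(s i); case: (l i).2.
apply: preserving_comp; first exact: (inv_coords_preserving (fun i => ~~ (l i).2)).
exact: (preserving_reindex hK Hmu sK tK s_lt s_fix).
Qed.

End HaarPreserving.

(** * Versions measurable for the product sigma-algebra *)

Section Version.
Variables (R : realType) (K : ptopologicalType).
Hypothesis hK : hausdorff_space K.
Variable mu : probability (borel (Kinf K)) R.
Hypothesis rmu : inner_regular mu.
Implicit Types (J : set nat).

Definition cyl J : Type := g_sigma_algebraType (boxes (K := K) J).
HB.instance Definition _ J := Measurable.on (cyl J).

Definition depends_fun (T : Type) (p : Kinf K -> T) J :=
  forall k k' : Kinf K, (forall i, J i -> k i = k' i) -> p k = p k'.

Lemma ereal_inf_rat (x : R) :
  x%:E = ereal_inf [set (ratr q : R)%:E | q in [set q : rat | (x < ratr q)%R]].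
Proof.
apply/le_anti/andP; split.
  by apply: le_ereal_inf_tmp => _ [q /= xq <-]; rewrite lee_fin ltW.
apply/lee_addgt0Pr => e e0.
have /rat_in_itvoo[q] : (x < x + e)%R by rewrite ltrDl.
rewrite inE /= => /andP[xq qe].
apply: (@le_trans _ _ (ratr q : R)%:E); last by rewrite -EFinD lee_fin ltW.
by apply: ereal_inf_lbound; exists q.
Qed.

(** Each sublevel set of [p] at a rational [q] agrees up to a null set with some [B q] measurable in
    [cyl J]. The version is the infimum of the rationals [q] with [k] in [B q]; off countably many
    null sets it equals [p k]. *)
Lemma cyl_version J (p : borel (Kinf K) -> R) :
  measurable_fun setT p -> depends_fun p J ->
  exists p' : cyl J -> R, measurable_fun setT p' /\
    p = (p' : borel (Kinf K) -> R) %[ae mu].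
Proof.
move=> mp dp.
pose A (q : rat) : set (borel (Kinf K)) := [set k | (p k < ratr q)%R].
have mA q : measurable (A q).
  rewrite (_ : A q = setT `&` p @^-1` `]-oo, ratr q[%classic).
    by apply: mp => //; exact: measurable_itv.
  by apply/seteqP; split=> k; rewrite /A /= in_itv //= => -[].
have dA q : depends (A q) J by move=> k k' kk'; rewrite /A /= (dp k k' kk').
have mu1 : mu setT < +oo by rewrite probability_setT ltry.
have repA q : exists B, [/\ <<s boxes J >> B, mu (A q `\` B) = 0 & mu (B `\` A q) = 0].
  exact: borel_sigma_boxes.
pose B q := projT1 (cid (repA q)).
have BP q : [/\ <<s boxes J >> (B q), mu (A q `\` B q) = 0 & mu (B q `\` A q) = 0].
  by rewrite /B; case: cid.
pose F q (k : cyl J) : \bar R := if k \in B q then (ratr q : R)%:E else +oo.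
have mF q : measurable_fun setT (F q).
  apply: measurable_fun_ifT => //.
  apply: (measurable_fun_bool true).
  rewrite setTI (_ : _ @^-1` _ = B q); first by have [] := BP q.
  by apply/seteqP; split=> k /=; [move=> /set_mem|move=> Bk; exact: mem_set].
(* Codes that decode to nothing repeat the rational [0], which is harmless in an infimum. *)
pose qn i : rat := odflt 0%R (unpickle i).
pose P (k : cyl J) := ereal_inf (range (fun i => F (qn i) k)).
have mP : measurable_fun setT P.
  rewrite (_ : P = fun k => einfs (fun i => F (qn i) k) 0%N); last first.
    apply/funext => k; rewrite /P /einfs /sdrop; congr ereal_inf.
    by apply/seteqP; split=> x [i _ <-]; exists i.
  by apply: measurable_fun_einfs.
exists (fine \o P); split; first exact: measurableT_comp.
have aeAB : \forall k \ae mu, forall i, A (qn i) k <-> B (qn i) k.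
  apply: ae_foralln => i; have [sB H1 H2] := BP (qn i).
  have mB := sigma_boxes_borel sB.
  exists ((A (qn i) `\` B (qn i)) `|` (B (qn i) `\` A (qn i))); split.
  - by apply: measurableU; apply: measurableD.
  - apply/eqP; rewrite -measure_le0 -[leRHS]adde0 -{1}H1 -H2.
    by apply: measureU2; exact: measurableD.
  - move=> k /= nAB; have [Ak|nAk] := pselect (A (qn i) k).
      by left; split=> // Bk; apply: nAB.
    by right; split=> //; apply: contrapT => nBk; apply: nAB; split.
apply: filterS aeAB => k AB _.
suff PE : P k = (p k)%:E by rewrite /= PE.
rewrite /P (ereal_inf_rat (p k)).
apply/le_anti/andP; split.
  apply: le_ereal_inf_tmp => _ [q pq <-]; apply: ereal_inf_lbound.
  exists (pickle q) => //; rewrite /F /qn pickleK /=.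
  have /AB : A (qn (pickle q)) k by rewrite /qn pickleK.
  by rewrite /qn pickleK /= => Bk; rewrite mem_set.
apply: le_ereal_inf_tmp => _ [i _ <-]; rewrite /F; case: ifPn => [|_]; last exact: leey.
rewrite inE => /AB Ak; apply: ereal_inf_lbound; exists (qn i) => //.
Qed.

(** The level set of [p] through [k] lies in the sigma-algebra of [J], so it contains [k'] along
    with [k]. *)
Lemma measurable_cyl_depends J (p : cyl J -> R) :
  measurable_fun setT p -> depends_fun (p : Kinf K -> R) J.
Proof.
move=> mp k k' kk'.
have sp : <<s boxes J >> (p @^-1` [set p k]).
  have := mp measurableT _ (measurable_set1 (p k)); by rewrite setTI.
have := sigma_boxes_depends sp kk' (erefl (p k)); by [].
Qed.

Lemma measurable_cyl_sub J (p : Kinf K -> R) :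
  measurable_fun setT (p : cyl J -> R) -> measurable_fun setT (p : cyl setT -> R).
Proof.
move=> mp _ B mB; rewrite setTI.
have : <<s boxes J >> (p @^-1` B) by have := mp measurableT B mB; rewrite setTI.
apply: sub_sigma_algebra2 => _ [N [A [mA JA ->]]]; exists N, A; split=> // i; by move=> /(_ I).
Qed.

Lemma measurable_cyl_borel J (p : Kinf K -> R) :
  measurable_fun setT (p : cyl J -> R) ->
  measurable_fun setT (p : borel (Kinf K) -> R).
Proof.
move=> mp _ B mB; rewrite setTI; apply: (@sigma_boxes_borel K J).
by have := mp measurableT B mB; rewrite setTI.
Qed.

End Version.

Local Close Scope ereal_scope.

(** * Square-integrable real functions on a probability space *)

Section SquareIntegrable.
Context d (T : measurableType d) (R : realType) (P : probability T R).
Implicit Types f g : T -> R.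

Lemma integrable_EFinB f g : P.-integrable setT (EFin \o f) ->
  P.-integrable setT (EFin \o g) -> P.-integrable setT (EFin \o (fun x => f x - g x)).
Proof. by move=> /(integrableB measurableT) /[apply]; exact: eq_integrable. Qed.

Lemma integrable_EFinD f g : P.-integrable setT (EFin \o f) ->
  P.-integrable setT (EFin \o g) -> P.-integrable setT (EFin \o (fun x => f x + g x)).
Proof. by move=> /(integrableD measurableT) /[apply]; exact: eq_integrable. Qed.

Lemma integrable_EFinZ r f : P.-integrable setT (EFin \o f) ->
  P.-integrable setT (EFin \o (fun x => r * f x)).
Proof. by move=> /(integrableZl measurableT r); exact: eq_integrable. Qed.

Definition sq_int f :=
  measurable_fun setT f /\ P.-integrable setT (EFin \o (fun x => f x ^+ 2)).

Lemma sq_int_mul f g : sq_int f -> sq_int g ->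
  P.-integrable setT (EFin \o (fun x => f x * g x)).
Proof.
move=> [mf f2] [mg g2].
apply: (@le_integrable _ _ _ P _ measurableT _
    ((EFin \o (fun x => f x ^+ 2)%R) \+ (EFin \o (fun x => g x ^+ 2)%R))%E).
- by apply/measurable_EFinP; exact: measurable_funM.
- move=> x _ /=; rewrite lee_fin.
  rewrite [leRHS]ger0_norm ?addr_ge0 ?sqr_ge0 //.
  by rewrite ler_norml; apply/andP; split; nra.
- exact: integrableD.
Qed.

Lemma sq_int_cst c : sq_int (fun=> c).
Proof.
split; first exact: measurable_cst.
exact: finite_measure_integrable_cst.
Qed.

Lemma sq_int_integrable f : sq_int f -> P.-integrable setT (EFin \o f).
Proof.
move=> /sq_int_mul/(_ (sq_int_cst 1)); apply: eq_integrable => // x _ /=.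
by rewrite mulr1.
Qed.

Lemma sq_intB f g : sq_int f -> sq_int g -> sq_int (fun x => f x - g x).
Proof.
move=> Lf Lg; have [mf f2] := Lf; have [mg g2] := Lg.
split; first exact: measurable_funB.
have fg := sq_int_mul Lf Lg.
have := integrable_EFinB (integrable_EFinD f2 g2) (integrable_EFinZ 2 fg).
by apply: eq_integrable => // x _ /=; congr EFin; ring.
Qed.

(** The variance of [f] is nonnegative. *)
Lemma Rintegral_sqr_le f : P.-integrable setT (EFin \o f) ->
  P.-integrable setT (EFin \o (fun x => f x ^+ 2)) ->
  (\int[P]_x f x) ^+ 2 <= \int[P]_x (f x ^+ 2).
Proof.
move=> if1 if2; set c := \int[P]_x f x.
have ic : P.-integrable setT (EFin \o (fun=> c ^+ 2)).
  exact: finite_measure_integrable_cst.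
have icf : P.-integrable setT (EFin \o (fun x => (2 * c) * f x)).
  exact: integrable_EFinZ.
have i2 : P.-integrable setT (EFin \o (fun x => f x ^+ 2 - (2 * c) * f x)).
  exact: integrable_EFinB.
have : 0 <= \int[P]_x ((f x ^+ 2 - (2 * c) * f x) + c ^+ 2).
  apply: Rintegral_ge0 => x _.
  have -> : f x ^+ 2 - 2 * c * f x + c ^+ 2 = (f x - c) ^+ 2 by ring.
  exact: sqr_ge0.
rewrite RintegralD // RintegralB // RintegralZl // -/c Rintegral_cst //.
rewrite -[X in fine X]/(P setT) [X in fine X]probability_setT /=.
by move: (\int[P]_x (f x ^+ 2)) => a; nra.
Qed.

Lemma Rintegral_ae f g : P.-integrable setT (EFin \o f) ->
  P.-integrable setT (EFin \o g) -> f = g %[ae P] ->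
  \int[P]_x f x = \int[P]_x g x.
Proof.
move=> if_ ig fg; rewrite /Rintegral; congr fine; apply: ae_eq_integral => //.
- exact: measurable_int if_.
- exact: measurable_int ig.
- by apply: filterS fg => x /[apply] ->.
Qed.

Lemma sq_int_ae f g : sq_int f -> measurable_fun setT g -> f = g %[ae P] -> sq_int g.
Proof.
move=> [mf f2] mg fg; split=> //; apply/integrableP; split.
  by apply/measurable_EFinP; exact: measurable_funX.
have mabs (h : T -> R) : measurable_fun setT h -> measurable_fun setT (fun x => `|(h x ^+ 2)%:E|%E).
  move=> mh; rewrite (_ : (fun x => _) = abse \o (EFin \o (fun x => h x ^+ 2))) //.
  apply: measurableT_comp => //; apply/measurable_EFinP; exact: measurable_funX.
have /integrableP[_ /=] := f2.
rewrite (_ : (\int[P]_x _)%E = (\int[P]_x `|(g x ^+ 2)%:E|)%E) //.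
apply: ae_eq_integral => //; [exact: mabs|exact: mabs|].
by apply: filterS fg => x /[apply] ->.
Qed.

Lemma sq_int_eq0 f : sq_int f -> \int[P]_x (f x ^+ 2) = 0 -> f = (fun=> 0) %[ae P].
Proof.
move=> [mf f2] f20.
have int0 : (\int[P]_x `|(f x ^+ 2)%:E| = 0)%E.
  under eq_integral do rewrite gee0_abs ?lee_fin ?sqr_ge0 //.
  by rewrite -[LHS]fineK ?[fine _]f20 //; exact: integrable_fin_num.
have /(ae_eq_integral_abs P measurableT) : measurable_fun setT (fun x => (f x ^+ 2)%:E).
  by apply/measurable_EFinP; exact: measurable_funX.
move=> [/(_ int0) + _]; apply: filterS => x /[apply] -[] /eqP.
by rewrite sqrf_eq0 => /eqP.
Qed.

End SquareIntegrable.

(** * Integrating out coordinates *)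

Local Open Scope ereal_scope.

Section ProductMeasure.
Variables (R : realType) (K : ptopologicalType).
Variables (lambda : probability (borel K) R) (mu : probability (borel (Kinf K)) R).
Hypothesis Hmu : product_probability lambda mu.
Implicit Types (A : nat -> set (borel K)).

Local Notation S := (@cyl K setT).

Let to_cyl : borel (Kinf K) -> S := fun k => k.

Let measurable_to_cyl : measurable_fun setT to_cyl.
Proof. by move=> _ B mB; rewrite setTI; exact: sigma_boxes_borel mB. Qed.

Let to_cyl_mfun : {mfun borel (Kinf K) >-> S} :=
  HB.pack to_cyl (@isMeasurableFun.Build _ _ _ _ _ measurable_to_cyl).

(** The restriction of [mu] to the product sigma-algebra, as an image under the identity. Gluing two
    sequences with [split_at] is measurable for this sigma-algebra, which opens the way to
    Fubini. *)
Definition cyl_measure : probability S R := distribution mu to_cyl_mfun.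
Local Notation m0 := cyl_measure.

Let cyl_cylinder N A : (forall i, measurable (A i)) ->
  m0 (cylinder N A) = \prod_(i < N) lambda (A i).
Proof. by move=> mA; have [_] := Hmu; exact. Qed.

Lemma measurable_cylinderS N A : (forall i, measurable (A i)) ->
  measurable (cylinder N A : set S).
Proof. by move=> mA; apply: sub_sigma_algebra; exists N, A; split=> // i /(_ I). Qed.

Lemma measurable_cylP d (T : measurableType d) (f : T -> S) :
  (forall i, measurable_fun setT ((fun t => f t i) : T -> borel K)) ->
  measurable_fun setT f.
Proof.
move=> mf; apply: (@measurability _ _ T S setT f (boxes setT)) => //.
move=> _ [_ [N [A [mA _ ->]]] <-]; rewrite setTI.
elim: N => [|N IHN].
  by rewrite (_ : cylinder 0 A = setT) ?preimage_setT //; apply/seteqP; split.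
rewrite cylinderS preimage_setI; apply: measurableI => //.
by have := mf N measurableT _ (mA N); rewrite setTI.
Qed.

Lemma measurable_cyl_coord i : measurable_fun setT ((fun k => k i) : S -> borel K).
Proof.
by move=> _ B mB; rewrite setTI; exact: (@sigma_boxes_coord K setT i B I mB).
Qed.

(* The first c coordinates of kk.1, followed by those of kk.2 from c - s on *)
Definition split_at (c s : nat) (kk : Kinf K * Kinf K) : Kinf K :=
  fun i => if (i < c)%N then kk.1 i else kk.2 (i - s)%N.

Lemma measurable_split_at c s : measurable_fun setT (split_at c s : S * S -> S).
Proof.
apply: measurable_cylP => i; rewrite /split_at; case: (i < c)%N.
  apply: (measurableT_comp (f := (fun k : S => k i : borel K))) => //.
  exact: measurable_cyl_coord.
apply: (measurableT_comp (f := (fun k : S => k (i - s)%N : borel K))) => //.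
exact: measurable_cyl_coord.
Qed.

(** Two independent samples are glued along disjoint ranges: the coordinates below [m + j] of one,
    and those from [m] on of the other, shifted by [j]. On cylinders both sides are the same
    product. *)
Lemma split_at_law m j (B : set S) : measurable B ->
  (m0 \x m0) (split_at (m + j) j @^-1` B) = m0 B.
Proof.
pose m2 : {measure set (S * S) -> \bar R} := (m0 \x m0)%E.
pose f := split_at (m + j) j : S * S -> S.
have mf : measurable_fun setT f by exact: measurable_split_at.
pose nu_ := (pushforward m2 f : {measure set S -> \bar R}).
pose nu : {measure set S -> \bar R} := nu_ mf.
have nuE (C : set S) : nu C = m2 (f @^-1` C) by [].
move=> mB; apply/esym; transitivity (nu B); last by [].
apply: (@g_sigma_algebra_measure_unique _ R S (boxes setT) _ (fun=> setT) _ _ m0 nu _ _ _ B mB).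
- exact: sub_sigma_algebra.
- by move=> _; exists 0%N, (fun=> setT); split=> //; apply/seteqP; split.
- by apply/seteqP; split=> // k _; exists 0%N.
- exact: setI_closed_boxes.
- move=> _ [N0 [A0 [mA0 _ ->]]].
  pose A i := if (i < N0)%N then A0 i else setT.
  have mA i : measurable (A i) by rewrite /A; case: ifP.
  have -> : cylinder N0 A0 = cylinder (m + j + N0) A by apply: cylinder_le; lia.
  pose A' l := if (l < m)%N then setT else A (l + j)%N.
  have mA' l : measurable (A' l) by rewrite /A'; case: ifP.
  have -> : nu (cylinder (m + j + N0) A) =
      m2 (cylinder (m + j) A `*` cylinder (m + N0) A').
    congr (m2 _); apply/seteqP; split=> [[k k'] H|[k k'] [H1 H2] i iN].
      split=> [i im|l lm] /=.
        have im' : (i < m + j + N0)%N by lia.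
        by have := H i im'; rewrite /f /split_at im.
      rewrite /A'; case: ltnP => // ml; have lN : (l + j < m + j + N0)%N by lia.
      have := H _ lN; rewrite /f /split_at /= ltn_add2r ltnNge ml /=.
      by rewrite addnK.
    rewrite /f /split_at; case: ltnP => [im|mi]; first exact: H1.
    have lN : (i - j < m + N0)%N by lia.
    have := H2 _ lN; rewrite /A' /= (_ : (i - j < m)%N = false); last by lia.
    by rewrite subnK //; lia.
  have -> : m2 (cylinder (m + j) A `*` cylinder (m + N0) A') =
      m0 (cylinder (m + j) A) * m0 (cylinder (m + N0) A').
    by apply: product_measure1E; exact: measurable_cylinderS.
  transitivity (\prod_(i < m + j + N0) lambda (A i)); first exact: cyl_cylinder.
  rewrite !cyl_cylinder // [LHS]big_split_ord /=; congr (_ * _).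
  rewrite [RHS]big_split_ord /= [X in _ = X * _]big1 ?mul1e.
    apply: eq_bigr => l _; rewrite /A' (_ : (m + l < m)%N = false); last by lia.
    by congr (lambda (A _)); lia.
  by move=> l _; rewrite /A' ltn_ord probability_setT.
- by move=> _; apply: (@le_lt_trans _ _ 1); [rewrite -(probability_setT m0)|exact: ltry].
Qed.

End ProductMeasure.

Section ConditionalExpectation.
Variables (R : realType) (K : ptopologicalType).
Variables (lambda : probability (borel K) R) (mu : probability (borel (Kinf K)) R).
Hypothesis Hmu : product_probability lambda mu.

Local Notation S := (@cyl K setT).
Local Notation m0 := (cyl_measure mu).

Lemma ge0_integral_split m j (g : S -> \bar R) : measurable_fun setT g ->
  (forall k, 0 <= g k) ->
  \int[m0 \x m0]_z g (split_at (m + j) j z) = \int[m0]_k g k.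
Proof.
move=> mg g0; have ms := @measurable_split_at K (m + j) j.
have := @ge0_integral_pushforward _ _ _ S R _ ms (m0 \x m0)%E setT g measurableT mg.
rewrite preimage_setT => /(_ (fun x _ => g0 x)) <-.
apply: eq_measure_integral => B mB _.
exact: (split_at_law Hmu m j mB).
Qed.

Lemma integrable_split m j (f : S -> R) : m0.-integrable setT (EFin \o f) ->
  (m0 \x m0).-integrable setT (EFin \o (fun z => f (split_at (m + j) j z))).
Proof.
move=> /integrableP[mf fi]; have ms := @measurable_split_at K (m + j) j.
apply/integrableP; split; first exact: (measurableT_comp mf ms).
rewrite (@ge0_integral_split m j (fun k => `|(f k)%:E|)) //.
exact: measurableT_comp.
Qed.

Lemma integral_split m j (f : S -> R) : m0.-integrable setT (EFin \o f) ->
  \int[m0 \x m0]_z (f (split_at (m + j) j z))%:E = \int[m0]_k (f k)%:E.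
Proof.
move=> fi; have ms := @measurable_split_at K (m + j) j.
have mf := measurable_int _ fi.
have := @integral_pushforward _ _ _ S R _ ms (m0 \x m0)%E setT (EFin \o f) mf.
rewrite preimage_setT => /(_ (integrable_split m j fi) measurableT) /= <-.
apply: eq_measure_integral => B mB _.
exact: (split_at_law Hmu m j mB).
Qed.

(* The coordinates from m on are integrated out *)
Definition cond_exp m (F : Kinf K -> R) (k : Kinf K) : R :=
  (\int[m0]_k' F (split_at m 0 (k, k')))%R.

Lemma cond_exp_depends m F : depends_fun (cond_exp m F) [set i | (i < m)%N].
Proof.
move=> k k' kk'; rewrite /cond_exp; congr fine; apply: eq_integral => k1 _.
congr (EFin (F _)); apply/funext => i; rewrite /split_at /=.
by case: ifP => // im; exact: kk'.
Qed.

Lemma measurable_cond_exp m (F : S -> R) : m0.-integrable setT (EFin \o F) ->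
  measurable_fun setT (cond_exp m F : S -> R).
Proof.
move=> iF; have iF2 := integrable_split m 0 iF; rewrite addn0 in iF2.
apply: (measurableT_comp (f := fine)) => //.
exact: (measurable_fubini_F iF2).
Qed.

(** Jensen's inequality for the square on almost every fibre, integrated by Fubini. *)
Lemma cond_exp_sq_int m (F : S -> R) : sq_int m0 F ->
  sq_int m0 (cond_exp m F : S -> R).
Proof.
move=> sF; have iF := sq_int_integrable sF; have [mF F2] := sF.
have mE := measurable_cond_exp m iF; split=> //.
have iF1 := integrable_split m 0 iF; rewrite addn0 in iF1.
have iF2 := integrable_split m 0 F2; rewrite addn0 in iF2.
apply/integrableP; split; first by apply/measurable_EFinP; exact: measurable_funX.
have /integrableP[_ F2oo] := F2.
apply: le_lt_trans F2oo.
under [leRHS]eq_integral do rewrite /= ger0_norm ?sqr_ge0 //.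
rewrite -(integral_split m 0 F2) addn0 -(integral12_prod_meas1 iF2).
apply: ae_ge0_le_integral => //.
- apply: measurableT_comp => //; apply/measurable_EFinP; exact: measurable_funX.
- by move=> k _; apply: integral_ge0 => k' _; rewrite lee_fin sqr_ge0.
- exact: (measurable_fubini_F iF2).
have a1 := ae_integrable1 iF1; have a2 := ae_integrable1 iF2.
apply: filterS2 a1 a2 => k i1 i2 _ /=.
rewrite ger0_norm ?sqr_ge0 // -[leRHS]fineK; last exact: integrable_fin_num.
by rewrite lee_fin; exact: Rintegral_sqr_le.
Qed.

(** Here [alpha] is [act (theta m j)], or the identity with [j = 0]. On the glued sample [Q] sees
    only the first component, while [F] after [alpha] sees the coordinates below [m] of the first
    and the others of the second; integrating over the second component averages [F]. *)
Lemma cond_exp_integral m j (F Q : S -> R) (alpha : S -> S) :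
  sq_int m0 F -> measurable_fun setT Q ->
  m0.-integrable setT (EFin \o (fun k => F (alpha k) * Q k)%R) ->
  (forall z, F (alpha (split_at (m + j) j z)) = F (split_at m 0 z)) ->
  (forall z, Q (split_at (m + j) j z) = Q z.1) ->
  (\int[m0]_k (F (alpha k) * Q k) = \int[m0]_k (cond_exp m F k * Q k))%R.
Proof.
move=> sF mQ iFQ Falpha Qsplit; have iF := sq_int_integrable sF.
have i1 := integrable_split m 0 iF; rewrite addn0 in i1.
have iFQ2 := integrable_split m j iFQ.
rewrite /Rintegral -(integral_split m j iFQ).
have E z : (F (alpha (split_at (m + j) j z)) * Q (split_at (m + j) j z) =
    F (split_at m 0 z) * Q z.1)%R by rewrite Falpha Qsplit.
have iG : (m0 \x m0).-integrable setT (EFin \o (fun z => F (split_at m 0 z) * Q z.1)%R).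
  by apply: eq_integrable iFQ2 => // z _ /=; rewrite E.
rewrite (eq_integral (fun z : S * S => (F (split_at m 0 z) * Q z.1)%:E)); last first.
  by move=> z _; congr EFin; exact: E.
rewrite -(integral12_prod_meas1 iG); congr fine.
apply: ae_eq_integral => //.
- exact: (measurable_fubini_F iG).
- by apply/measurable_EFinP; apply: measurable_funM => //; exact: measurable_cond_exp.
apply: filterS (ae_integrable1 i1) => k ik _ /=.
rewrite /fubini_F /=.
under eq_integral do rewrite EFinM.
rewrite integralZr // EFinM fineK //; exact: integrable_fin_num.
Qed.

End ConditionalExpectation.

Local Close Scope ereal_scope.

(** * The representation *)

Section RealProjection.
Variables (R : realType) (K : topologicalGroupType).
Hypothesis hK : hausdorff_space K.
Variables (lambda : probability (borel K) R) (mu : probability (borel (Kinf K)) R).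
Hypothesis Hmu : product_probability lambda mu.

Local Notation T := (borel (Kinf K)).
Local Notation S := (@cyl K setT).
Local Notation m0 := (cyl_measure mu).
Local Notation upto n := [set i | (i < n)%N].
Implicit Types (f p q : T -> R) (phi psi : Kinf K -> Kinf K).

Definition cylindrical (n : nat) f := exists2 p : T -> R,
  measurable_fun setT p /\ depends_fun (p : Kinf K -> R) (upto n) & f = p %[ae mu].

Let mid : measurable_fun setT ((fun k => k) : T -> S).
Proof. by move=> _ B mB; rewrite setTI; exact: sigma_boxes_borel mB. Qed.

Lemma cyl_integral_ge0 (f : S -> \bar R) : measurable_fun setT f ->
  (forall k, (0 <= f k)%E) -> (\int[m0]_k f k = \int[mu]_k f k)%E.
Proof.
move=> mf f0.
by rewrite [LHS](ge0_integral_pushforward mid mu measurableT mf (fun x _ => f0 x)).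
Qed.

Lemma cyl_integrable (f : S -> \bar R) : measurable_fun setT f ->
  m0.-integrable setT f <-> mu.-integrable setT (f : T -> \bar R).
Proof.
move=> mf; have E : (\int[m0]_k `|f k| = \int[mu]_k `|f k|)%E.
  by apply: cyl_integral_ge0 => //; exact: measurableT_comp.
split=> /integrableP[_ fi]; apply/integrableP; split=> //.
- exact: (measurableT_comp mf mid).
- by rewrite -E.
- by rewrite E.
Qed.

Lemma cyl_sq_int (f : S -> R) : measurable_fun setT f ->
  sq_int m0 f <-> sq_int mu (f : T -> R).
Proof.
move=> mf; have mf2 : measurable_fun setT (EFin \o (fun k => f k ^+ 2)).
  by apply/measurable_EFinP; exact: measurable_funX.
split=> -[_ /(cyl_integrable mf2) f2]; split=> //.
exact: (measurableT_comp mf mid).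
Qed.

Lemma cyl_Rintegral (f : S -> R) : m0.-integrable setT (EFin \o f) ->
  \int[m0]_k f k = \int[mu]_k f k.
Proof.
move=> fi; have mf := measurable_int _ fi; congr fine.
have fi' : mu.-integrable setT ((EFin \o f) : T -> \bar R) by exact/cyl_integrable.
by rewrite [LHS](integral_pushforward mid mf fi' measurableT).
Qed.

Lemma cylindrical_version n f : sq_int mu f -> cylindrical n f ->
  exists F : Kinf K -> R, [/\ measurable_fun setT (F : S -> R),
    depends_fun F (upto n), sq_int mu F, sq_int m0 F & f = F %[ae mu]].
Proof.
move=> sf [p [mp dp] fp]; have rmu : inner_regular mu by have [] := Hmu.
have [F [mF pF]] := cyl_version hK rmu mp dp.
have mFS := measurable_cyl_sub mF.
have fF : f = (F : T -> R) %[ae mu].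
  by apply: filterS2 fp pF => k + + _ => /(_ I) -> /(_ I).
have sF : sq_int mu F by apply: sq_int_ae sf _ fF; exact: measurable_cyl_borel mF.
exists F; split=> //; first exact: measurable_cyl_depends.
exact/cyl_sq_int.
Qed.

Lemma cylindricalB n p q : cylindrical n p -> cylindrical n q ->
  cylindrical n (fun k => p k - q k).
Proof.
move=> [p' [mp dp] pp'] [q' [mq dq] qq']; exists (fun k => p' k - q' k).
  split; first exact: measurable_funB.
  by move=> k k' kk'; rewrite (dp k k') ?(dq k k').
by apply: filterS2 pp' qq' => k + + _ => /(_ I) -> /(_ I) ->.
Qed.

(** Projection onto all square-integrable functions of the first [m] coordinates; invariance under
    [U] is recovered in [real_projection_invariant]. *)
Definition is_real_projection m f p := [/\ sq_int mu p, cylindrical m p &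
  forall q, sq_int mu q -> cylindrical m q ->
    \int[mu]_k (f k * q k) = \int[mu]_k (p k * q k)].

Lemma Rintegral_mul_ae f f' q q' : sq_int mu f -> sq_int mu f' ->
  sq_int mu q -> sq_int mu q' -> f = f' %[ae mu] -> q = q' %[ae mu] ->
  \int[mu]_k (f k * q k) = \int[mu]_k (f' k * q' k).
Proof.
move=> sf sf' sq sq' ff' qq'; apply: Rintegral_ae; [exact: sq_int_mul|exact: sq_int_mul|].
by apply: filterS2 ff' qq' => k + + _ => /(_ I) -> /(_ I) ->.
Qed.

Lemma real_projection_unique m f p p' : is_real_projection m f p ->
  is_real_projection m f p' -> p = p' %[ae mu].
Proof.
move=> [sp cp Hp] [sp' cp' Hp']; have sd := sq_intB sp sp'; have cd := cylindricalB cp cp'.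
have : (fun k => p k - p' k) = (fun=> 0) %[ae mu].
  apply: sq_int_eq0 => //.
  have E : \int[mu]_k (p k * (p k - p' k)) - \int[mu]_k (p' k * (p k - p' k)) = 0.
    by rewrite -Hp // -Hp' // subrr.
  rewrite -E -RintegralB //; [|exact: sq_int_mul|exact: sq_int_mul].
  by apply: eq_Rintegral => k _; rewrite -mulrBl.
by apply: filterS => k /[apply] /eqP; rewrite subr_eq0 => /eqP.
Qed.

Lemma act_thetaE m j (k : Kinf K) i : act (theta m j) k i = k (theta_index m j i).
Proof. by rewrite /act /theta /xgen !fg_lift_gen. Qed.

Lemma preserving_sq_int phi f : preserving mu phi -> sq_int mu f ->
  sq_int mu (f \o phi).
Proof.
move=> [cphi mphi] [mf f2].
have mp : measurable_fun setT (phi : T -> T) by exact: continuous_borel.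
have mfp : measurable_fun setT (f \o phi : T -> R) by exact: (measurableT_comp mf mp).
split=> //; apply/integrableP; split.
  by apply/measurable_EFinP; exact: measurable_funX.
have /integrableP[mf2 f2oo] := f2; apply: le_lt_trans f2oo.
have mabs : measurable_fun setT (abse \o (EFin \o (fun k => f k ^+ 2))).
  exact: measurableT_comp.
have := ge0_integral_pushforward mp mu measurableT mabs (fun x _ => abse_ge0 _).
rewrite preimage_setT => E; rewrite le_eqVlt; apply/orP; left; apply/eqP.
rewrite -[LHS]E; apply: eq_measure_integral => B mB _; exact: mphi.
Qed.

Lemma preserving_Rintegral phi f : preserving mu phi ->
  mu.-integrable setT (EFin \o f) -> mu.-integrable setT (EFin \o (f \o phi)) ->
  \int[mu]_k f (phi k) = \int[mu]_k f k.
Proof.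
move=> [cphi mphi] fi fpi.
have mp : measurable_fun setT (phi : T -> T) by exact: continuous_borel.
have mf := measurable_int _ fi.
congr fine; have := @integral_pushforward _ _ _ _ _ _ mp mu setT _ mf.
rewrite preimage_setT => /(_ fpi measurableT) /= <-.
by apply: eq_measure_integral => B mB _; exact: mphi.
Qed.

Lemma preserving_ae (V : Type) phi (f g : T -> V) : preserving mu phi ->
  f = g %[ae mu] -> (f \o phi) = (g \o phi) %[ae mu].
Proof.
move=> pphi [N [mN N0 fgN]]; exists (phi @^-1` N); split.
- exact: (preserving_measurable pphi mN).
- by have [_ ->] := pphi.
- by move=> k /= H; exact: fgN.
Qed.

Lemma preserving_adjoint phi psi f q : preserving mu phi -> preserving mu psi ->
  cancel phi psi -> sq_int mu f -> sq_int mu q ->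
  \int[mu]_k (f (phi k) * q k) = \int[mu]_k (f k * q (psi k)).
Proof.
move=> pphi ppsi phiK sf sq.
have sqp := preserving_sq_int ppsi sq; have sfp := preserving_sq_int pphi sf.
rewrite -(@preserving_Rintegral phi (fun k => f k * q (psi k))) //.
- by apply: eq_Rintegral => k _; rewrite phiK.
- exact: sq_int_mul sf sqp.
- have := sq_int_mul sfp sq; apply: eq_integrable => // k _ /=.
  by rewrite phiK.
Qed.

(** The projection property and the clause on [theta m j] are one computation, [main], with [alpha]
    the identity and [act (theta m j)] respectively. *)
Lemma real_projection_exists m n f : sq_int mu f -> cylindrical n f ->
  exists p, [/\ is_real_projection m f p, measurable_fun setT p,
    depends_fun p (upto m) &
    forall j q, (n <= m + j)%N -> preserving mu (act (theta m j)) ->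
      sq_int mu q -> cylindrical n q ->
      \int[mu]_k (f (act (theta m j) k) * q k) = \int[mu]_k (p k * q k)].
Proof.
move=> sf cf; have [F [mF dF sF sF0 fF]] := cylindrical_version sf cf.
have iF0 := sq_int_integrable sF0.
have mP := measurable_cond_exp Hmu m iF0; have sP0 := cond_exp_sq_int Hmu m sF0.
pose p : T -> R := cond_exp mu m F; exists p.
have mp : measurable_fun setT p by exact: (measurableT_comp mP mid).
have dp : depends_fun p (upto m) by exact: cond_exp_depends.
have sp : sq_int mu p by exact/cyl_sq_int.
have cp : cylindrical m p by exists p => //; exact: aeW.
have main j n' q (alpha : Kinf K -> Kinf K) : (n' <= m + j)%N -> preserving mu alpha ->
    measurable_fun setT (alpha : S -> S) ->
    (forall z, F (alpha (split_at (m + j) j z)) = F (split_at m 0 z)) ->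
    sq_int mu q -> cylindrical n' q ->
    \int[mu]_k (f (alpha k) * q k) = \int[mu]_k (p k * q k).
  move=> nmj palpha malpha Fsplit sq cq.
  have [Q [mQ dQ sQ sQ0 qQ]] := cylindrical_version sq cq.
  have sFa := preserving_sq_int palpha sF; have sfa := preserving_sq_int palpha sf.
  have fFa := preserving_ae palpha fF.
  rewrite (Rintegral_mul_ae sfa sFa sq sQ fFa qQ).
  rewrite (Rintegral_mul_ae sp sp sq sQ (aeW _ _) qQ) //.
  have mFa : measurable_fun setT (F \o alpha : S -> R) by exact: (measurableT_comp mF malpha).
  have sFa0 : sq_int m0 (F \o alpha : S -> R) by exact/cyl_sq_int.
  have i1 := sq_int_mul sFa0 sQ0; have i2 := sq_int_mul sP0 sQ0.
  rewrite -(cyl_Rintegral i1) -(cyl_Rintegral i2).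
  apply: (cond_exp_integral (j := j) Hmu sF0 mQ i1 Fsplit) => z.
  by apply: dQ => i /= i_n; rewrite /split_at (leq_trans i_n nmj).
split=> //.
  split=> // q sq cq; apply: (main 0%N m q idfun) => //; rewrite ?addn0 //.
    exact: preserving_id.
  exact: measurable_id.
move=> j q nmj ptheta sq cq; apply: (main j n) => //.
  apply: measurable_cylP => i.
  rewrite (_ : (fun k => _) = (fun k : S => k (theta_index m j i) : borel K)).
    exact: measurable_cyl_coord.
  by apply/funext => k; rewrite act_thetaE.
(* For [m <= i < n] the coordinate read is [i + j]; it is at least [m + j], so it comes from the
   second component, at index [i]. *)
move=> z; apply: dF => i /= i_n; rewrite act_thetaE /theta_index /split_at.
have im2 : (i < m + j)%N by lia.
have [im|mi] := ltnP i m; first by rewrite im2.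
have imF : (i < m)%N = false by lia.
by rewrite im2 ltn_add2r imF addnK subn0.
Qed.

End RealProjection.

Section Representation.
Variables (R : realType) (K : topologicalGroupType).
Hypotheses (cK : compact [set: K]) (hK : hausdorff_space K).
Variables (lambda : probability (borel K) R) (mu : probability (borel (Kinf K)) R).
Hypotheses (Hlambda : haar_probability lambda) (Hmu : product_probability lambda mu).
Variable m : nat.

Local Notation T := (borel (Kinf K)).
Implicit Types (f p q : T -> R) (g h : Finf -> Finf) (n : nat).

Let pres g : GG g -> preserving mu (@act K g).
Proof. exact: (act_preserving cK hK Hlambda Hmu). Qed.

Lemma cylindrical_act n f h h' : cylindrical mu m f -> autn n h h' -> (m <= n)%N ->
  cylindrical mu n (f \o act h).
Proof.
move=> [p [mp dp] fp] ah mn.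
have ph : preserving mu (@act K h) by apply: pres; apply/GG_autn; exists n, h'.
exists (p \o act h); last exact: (preserving_ae ph fp).
split.
  by apply: measurableT_comp => //; apply: continuous_borel; exact: act_continuous.
move=> k k' kk'; apply: dp => i /= im; apply: fg_lift_eq_in kk' _.
by apply: (autn_Fsub ah); apply: (@Fsub_lett n (i, true)); exact: leq_trans im mn.
Qed.

(** This absorbs the factors from [HH m] in a representative of a double coset. *)
Lemma cylindrical_fixed f b : cylindrical mu m f -> HH m b ->
  (f \o act b) = f %[ae mu].
Proof.
move=> [p [mp dp] fp] [Gb bx].
have := preserving_ae (pres Gb) fp; move=> fpb.
apply: filterS2 fp fpb => k + + _ => /(_ I) -> /(_ I) /= ->.
by apply: dp => i /= im; rewrite /act bx // /xgen fg_lift_gen.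
Qed.

Lemma is_real_projection_ae F p p' : measurable_fun setT p' -> p = p' %[ae mu] ->
  is_real_projection mu m F p -> is_real_projection mu m F p'.
Proof.
move=> mp' pp' [sp [p0 P0 pp0] Hp]; have sp' := sq_int_ae sp mp' pp'; split=> //.
  by exists p0 => //; apply: filterS2 pp' pp0 => k + + _ => /(_ I) <- /(_ I).
move=> q sq cq; rewrite Hp //; apply: Rintegral_mul_ae => //.
exact: aeW.
Qed.

(** Adjunction moves [a] and [g] onto [q], while [b] disappears on [f] and the inverse of [a] on
    [q]. What remains pairs [f \o act h], moved by [theta m j], with [q \o act g'], both functions
    of the first [n] coordinates; so [f \o act h] may be replaced by its projection, and [g] is
    moved back. *)
Lemma real_product f q p a b g h n g' h' j :
  HH m a -> HH m b -> autn n g g' -> autn n h h' -> (m <= n)%N -> (n <= m + j)%N ->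
  sq_int mu f -> cylindrical mu m f -> sq_int mu q -> cylindrical mu m q ->
  is_real_projection mu m (f \o act h) p ->
  \int[mu]_k (f (act (a \o (g \o theta m j \o h) \o b) k) * q k) =
  \int[mu]_k (p (act g k) * q k).
Proof.
move=> Ha Hb ag ah mn nmj sf cf sq cq Hp.
have Gg : GG g by apply/GG_autn; exists n, g'.
have Gh : GG h by apply/GG_autn; exists n, h'.
have Gg' : GG g' by apply/GG_autn; exists n, g; exact: autn_sym.
have Gt := GG_theta m j.
have [Ga _] := Ha; have [Gb _] := Hb.
have [a' [Ha' aK a'K]] := HH_inv Ha; have [Ga' _] := Ha'.
have [gM g'M gK g'K _] := ag.
have sfh : sq_int mu (f \o act h) by apply: preserving_sq_int => //; exact: pres.
have cfh := cylindrical_act cf ah mn.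
have [p0 [Hp0 _ _ key]] := real_projection_exists hK Hmu m sfh cfh.
have actE : @act K (a \o (g \o theta m j \o h) \o b) =
    act b \o (act h \o (act (theta m j) \o (act g \o act a))).
  have tM := GG_morphism Gt; have hM := GG_morphism Gh; have aM := GG_morphism Ga.
  have M1 := morphism_comp gM tM; have M2 := morphism_comp M1 hM.
  rewrite (act_comp K b (morphism_comp aM M2)) (act_comp K _ aM).
  by rewrite (act_comp K h M1) (act_comp K _ gM).
have pt := pres Gt; have pg := pres Gg; have pa := pres Ga; have ph := pres Gh.
have pg' := pres Gg'; have pa' := pres Ga'.
have pga := preserving_comp pg pa; have ptga := preserving_comp pt pga.
have phtga := preserving_comp ph ptga.
pose F := f \o act h.
have sFt : sq_int mu (F \o act (theta m j)) by exact: preserving_sq_int.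
have sFtg : sq_int mu ((F \o act (theta m j)) \o act g) by exact: preserving_sq_int.
have sFtga : sq_int mu (((F \o act (theta m j)) \o act g) \o act a).
  exact: preserving_sq_int.
have fb := preserving_ae phtga (cylindrical_fixed cf Hb).
have sfb : sq_int mu (f \o act b \o (act h \o (act (theta m j) \o (act g \o act a)))).
  by apply: preserving_sq_int => //; apply: preserving_sq_int => //; exact: pres.
transitivity (\int[mu]_k ((((F \o act (theta m j)) \o act g) \o act a) k * q k)).
  rewrite actE; apply: Rintegral_mul_ae => //; exact: aeW.
have aM := GG_morphism Ga; have gg'K := @act_can K _ _ gM g'K.
rewrite (preserving_adjoint pa pa' (@act_can K _ _ aM a'K) sFtg sq).
have sqa := preserving_sq_int pa' sq.
rewrite (Rintegral_mul_ae sFtg sFtg sqa sq (aeW _ _) (cylindrical_fixed cq Ha')) //.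
rewrite (preserving_adjoint pg pg' gg'K sFt sq).
have sqg := preserving_sq_int pg' sq.
rewrite key //; last exact: cylindrical_act cq (autn_sym ag) mn.
have [sp0 _ _] := Hp0; have [sp _ _] := Hp.
rewrite -(preserving_adjoint pg pg' gg'K sp0 sq).
apply: Rintegral_mul_ae => //; [exact: preserving_sq_int|exact: preserving_sq_int| |exact: aeW].
exact: (preserving_ae pg (real_projection_unique Hp0 Hp)).
Qed.

End Representation.

(** * Complex functions and invariance under conjugation *)

Section ComplexProjection.
Variables (R : realType) (K : topologicalGroupType).
Hypotheses (cK : compact [set: K]) (hK : hausdorff_space K).
Variables (lambda : probability (borel K) R) (mu : probability (borel (Kinf K)) R).
Hypotheses (Hlambda : haar_probability lambda) (Hmu : product_probability lambda mu).
Variables (U : set K) (m : nat).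

Local Notation T := (borel (Kinf K)).
Local Notation re f := (fun k => complex.Re (f k)).
Local Notation im f := (fun k => complex.Im (f k)).
Implicit Types (f p q : T -> R[i]).

Lemma L2_components f : L2 mu f <-> sq_int mu (re f) /\ sq_int mu (im f).
Proof.
have E k : ComplexField.Normc.normc (f k) ^+ 2 =
    complex.Re (f k) ^+ 2 + complex.Im (f k) ^+ 2.
  by case: (f k) => a b /=; rewrite sqr_sqrtr // addr_ge0 ?sqr_ge0.
split=> [[[mr mi]]|[[mr r2] [mi i2]]].
  under eq_integral do rewrite E.
  move=> fin; have mr2 := measurable_funX 2 mr; have mi2 := measurable_funX 2 mi.
  have le_fin (s : T -> R) : measurable_fun setT s -> (forall k, 0 <= s k) ->
      (forall k, s k <= complex.Re (f k) ^+ 2 + complex.Im (f k) ^+ 2) ->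
      mu.-integrable setT (EFin \o s).
    move=> ms s0 sle; apply/integrableP; split; first exact/measurable_EFinP.
    apply: le_lt_trans fin; apply: ge0_le_integral => //.
    - by apply: measurableT_comp => //; exact/measurable_EFinP.
    - by apply/measurable_EFinP; exact: measurable_funD.
    - by move=> k _; rewrite /= lee_fin ger0_norm.
  have r2 := le_fin _ mr2 (fun k => sqr_ge0 _).
  have i2 := le_fin _ mi2 (fun k => sqr_ge0 _).
  split; split=> //; [apply: r2|apply: i2] => k.
    by rewrite lerDl sqr_ge0.
  by rewrite lerDr sqr_ge0.
split=> //; under eq_integral do rewrite E.
have /integrableP[_] := integrable_EFinD r2 i2; apply: le_lt_trans.
rewrite le_eqVlt; apply/orP; left; apply/eqP; apply: eq_integral => k _ /=.
by rewrite ger0_norm // addr_ge0 ?sqr_ge0.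
Qed.

Lemma ae_components f p : (re f) = (re p) %[ae mu] -> (im f) = (im p) %[ae mu] ->
  f = p %[ae mu].
Proof.
apply: filterS2 => k + + _ => /(_ I) + /(_ I).
by case: (f k) => a b; case: (p k) => c d /= -> ->.
Qed.

Let invariant (V : Type) (f : T -> V) :=
  forall u, U u -> (fun k : T => f (conj_act u k)) = f %[ae mu].

Lemma Hsub_components f : Hsub mu U m f <->
  [/\ sq_int mu (re f), sq_int mu (im f), cylindrical mu m (re f),
      cylindrical mu m (im f) & invariant f].
Proof.
split=> [[[L2f inv] [p [[mr mi] dp] fp]]|[sr si [p [mp dp] fp] [q [mq dq] fq] inv]].
  have [sr si] := (L2_components f).1 L2f; split=> //.
    exists (re p); first by split=> // k k' kk'; rewrite (dp k k').
    by apply: filterS fp => k /[apply] ->.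
  exists (im p); first by split=> // k k' kk'; rewrite (dp k k').
  by apply: filterS fp => k /[apply] ->.
split; first by split=> //; exact/L2_components.
exists (fun k => Complex (p k) (q k)); first split=> //.
  by move=> k k' kk'; rewrite (dp k k') ?(dq k k').
exact: ae_components.
Qed.

Lemma inner_components f q : sq_int mu (re f) -> sq_int mu (im f) ->
  sq_int mu (re q) -> sq_int mu (im q) ->
  inner mu f q = Complex
    (\int[mu]_k (complex.Re (f k) * complex.Re (q k)) +
     \int[mu]_k (complex.Im (f k) * complex.Im (q k)))
    (\int[mu]_k (complex.Im (f k) * complex.Re (q k)) -
     \int[mu]_k (complex.Re (f k) * complex.Im (q k))).
Proof.
move=> fr fi qr qi; rewrite /inner /cintegral.
rewrite -RintegralD //; [|exact: sq_int_mul|exact: sq_int_mul].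
rewrite -RintegralB //; [|exact: sq_int_mul|exact: sq_int_mul].
by congr Complex; apply: eq_Rintegral => k _;
  case: (f k) => a b; case: (q k) => c d /=; ring.
Qed.

Lemma complex_projection f p : sq_int mu (re f) -> sq_int mu (im f) ->
  Hsub mu U m p -> is_real_projection mu m (re f) (re p) ->
  is_real_projection mu m (im f) (im p) ->
  is_orthogonal_projection mu U m f p.
Proof.
move=> fr fi Hp [pr _ Pr] [pi _ Pi]; split=> // q /Hsub_components[qr qi cqr cqi _].
have Er k : complex.Re (f k - p k) = complex.Re (f k) - complex.Re (p k).
  by case: (f k) => a b; case: (p k).
have Ei k : complex.Im (f k - p k) = complex.Im (f k) - complex.Im (p k).
  by case: (f k) => a b; case: (p k).
have dr : sq_int mu (fun k => complex.Re (f k - p k)).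
  by rewrite (funext Er); exact: sq_intB.
have di : sq_int mu (fun k => complex.Im (f k - p k)).
  by rewrite (funext Ei); exact: sq_intB.
have B (v s t w : T -> R) : (forall k, v k = s k - t k) ->
    sq_int mu s -> sq_int mu t -> sq_int mu w ->
    \int[mu]_k (v k * w k) = \int[mu]_k (s k * w k) - \int[mu]_k (t k * w k).
  move=> vE ss st sw; rewrite -RintegralB //; [|exact: sq_int_mul|exact: sq_int_mul].
  by apply: eq_Rintegral => k _; rewrite vE mulrBl.
rewrite inner_components // !(B _ _ _ _ Er) // !(B _ _ _ _ Ei) //.
by rewrite !Pr // !Pi // !subrr addr0.
Qed.

(** Both conditions are tested against [d = p - p'], which lies in [H]. The difference of their real
    parts says that the square integrals of the two components of [d] add up to zero. *)
Lemma orthogonal_projection_unique f p p' : sq_int mu (re f) -> sq_int mu (im f) ->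
  is_orthogonal_projection mu U m f p -> is_orthogonal_projection mu U m f p' ->
  p = p' %[ae mu].
Proof.
move=> fr fi [Hp Pp] [Hp' Pp'].
have [pr pi cpr cpi ip] := (Hsub_components p).1 Hp.
have [pr' pi' cpr' cpi' ip'] := (Hsub_components p').1 Hp'.
have sub f1 f2 : [/\ (fun k => complex.Re (f1 k - f2 k)) =
      (fun k => complex.Re (f1 k) - complex.Re (f2 k)) :> (T -> R) &
    (fun k => complex.Im (f1 k - f2 k)) =
      (fun k => complex.Im (f1 k) - complex.Im (f2 k)) :> (T -> R)].
  by split; apply/funext => k; case: (f1 k) => a b; case: (f2 k).
pose d (k : T) := p k - p' k; have [dr di] := sub p p'.
have [er ei] := sub f p; have [er' ei'] := sub f p'.
have sdr : sq_int mu (re d) by rewrite [re d]dr; exact: sq_intB.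
have sdi : sq_int mu (im d) by rewrite [im d]di; exact: sq_intB.
have Hd : Hsub mu U m d.
  apply/Hsub_components; split=> //.
  - by rewrite [re d]dr; exact: cylindricalB.
  - by rewrite [im d]di; exact: cylindricalB.
  - move=> u Uu; have := ip' u Uu; have := ip u Uu; apply: filterS2 => k + + _.
    by rewrite /d => /(_ I) -> /(_ I) ->.
have inner_re f1 : sq_int mu (re f1) -> sq_int mu (im f1) -> inner mu f1 d = 0 ->
    \int[mu]_k (complex.Re (f1 k) * complex.Re (d k)) +
    \int[mu]_k (complex.Im (f1 k) * complex.Im (d k)) = 0.
  by move=> s1 s2; rewrite inner_components // => -[].
have e1 : sq_int mu (re (fun k => f k - p k)) by rewrite er; exact: sq_intB.
have e2 : sq_int mu (im (fun k => f k - p k)) by rewrite ei; exact: sq_intB.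
have e3 : sq_int mu (re (fun k => f k - p' k)) by rewrite er'; exact: sq_intB.
have e4 : sq_int mu (im (fun k => f k - p' k)) by rewrite ei'; exact: sq_intB.
have I1 := inner_re _ e1 e2 (Pp _ Hd); have I2 := inner_re _ e3 e4 (Pp' _ Hd).
have sqE (s s1 s2 : T -> R) : (forall k, s k = s2 k - s1 k) -> sq_int mu s ->
    sq_int mu s1 -> sq_int mu s2 ->
    \int[mu]_k (s k ^+ 2) = \int[mu]_k (s2 k * s k) - \int[mu]_k (s1 k * s k).
  move=> sE ss ss1 ss2; rewrite -RintegralB //; [|exact: sq_int_mul|exact: sq_int_mul].
  by apply: eq_Rintegral => k _; rewrite expr2 {1}sE mulrBl.
have dR k : complex.Re (d k) = complex.Re (f k - p' k) - complex.Re (f k - p k).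
  by rewrite /d; case: (f k) => ? ?; case: (p k) => ? ?; case: (p' k) => ? ? /=; ring.
have dI k : complex.Im (d k) = complex.Im (f k - p' k) - complex.Im (f k - p k).
  by rewrite /d; case: (f k) => ? ?; case: (p k) => ? ?; case: (p' k) => ? ? /=; ring.
have Sr := sqE _ _ _ dR sdr e1 e3; have Si := sqE _ _ _ dI sdi e2 e4.
have r0 : 0 <= \int[mu]_k (complex.Re (d k) ^+ 2) by apply: Rintegral_ge0 => k _; exact: sqr_ge0.
have i0 : 0 <= \int[mu]_k (complex.Im (d k) ^+ 2) by apply: Rintegral_ge0 => k _; exact: sqr_ge0.
have z1 : \int[mu]_k (complex.Re (d k) ^+ 2) = 0 by lra.
have z2 : \int[mu]_k (complex.Im (d k) ^+ 2) = 0 by lra.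
apply: filterS2 (sq_int_eq0 sdr z1) (sq_int_eq0 sdi z2) => k /(_ I) /= + /(_ I) /= + _.
rewrite /d; case: (p k) => a b; case: (p' k) => a' b' /=.
by move=> /eqP; rewrite subr_eq0 => /eqP -> /eqP; rewrite subr_eq0 => /eqP ->.
Qed.

(** The conjugate of [p0] is again a projection of [f0]: adjunction moves the conjugation to the
    test function, which still depends on the first [m] coordinates, and then back onto the
    invariant [f0]. *)
Lemma real_projection_invariant (f0 p0 : T -> R) u : U u ->
  sq_int mu f0 -> (fun k : T => f0 (conj_act u k)) = f0 %[ae mu] ->
  measurable_fun setT p0 ->
  is_real_projection mu m f0 p0 -> (fun k : T => p0 (conj_act u k)) = p0 %[ae mu].
Proof.
move=> Uu sf0 inv0 mp0 Hp; have [sp cp P] := Hp.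
have pu v : preserving mu (@conj_act K v) by exact: (conj_act_preserving cK hK Hlambda Hmu).
have conjK v : cancel (@conj_act K v) (@conj_act K v^-1%g).
  move=> k; apply/funext => i; rewrite /conj_act invgK !mulgA mulVg mul1g.
  by rewrite -mulgA mulVg mulg1.
have cyl_conj v (q : T -> R) : cylindrical mu m q -> cylindrical mu m (q \o conj_act v).
  move=> [q0 [mq dq] qq0]; exists (q0 \o conj_act v); last exact: (preserving_ae (pu v) qq0).
  split; first by apply: measurableT_comp => //; apply: continuous_borel; case: (pu v).
  by move=> k k' kk'; apply: dq => i im; rewrite /conj_act kk'.
apply: (real_projection_unique (m := m) (f := f0)) Hp; split.
- exact: (preserving_sq_int (pu u) sp).
- exact: cyl_conj.
move=> q sq cq.
have sqv := preserving_sq_int (pu u^-1%g) sq.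
rewrite (preserving_adjoint (pu u) (pu u^-1%g) (conjK u) sp sq).
rewrite -P //; last exact: cyl_conj.
rewrite -(preserving_adjoint (pu u) (pu u^-1%g) (conjK u) sf0 sq).
apply: Rintegral_mul_ae => //; last exact: aeW.
  exact: (preserving_sq_int (pu u) sf0).
by apply: filterS inv0 => k H1 _; rewrite H1.
Qed.

(** Conjugation by [u] is an endomorphism of [K], so it commutes with the evaluation of words. *)
Lemma act_conj g u (k : Kinf K) : act g (conj_act u k) = conj_act u (act g k).
Proof.
apply/funext => i; rewrite /act /conj_act.
apply/esym; apply: (@fg_lift_comp K K (fun x => (u * x * u^-1)%g)).
split=> [|x y]; first by rewrite mulg1 mulgV.
by rewrite !mulgA -[(_ * u^-1 * u)%g]mulgA mulVg mulg1.
Qed.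

(** The function assembled from the two real projections shows that the choice in [projH] is not its
    default value; uniqueness then carries the real characterisations over to the chosen
    function. *)
Lemma TbarP f g : GG g -> Hsub mu U m f ->
  [/\ Hsub mu U m (Tbar mu U m g f),
    is_real_projection mu m ((re f) \o act g) (re (Tbar mu U m g f)) &
    is_real_projection mu m ((im f) \o act g) (im (Tbar mu U m g f))].
Proof.
move=> Gg /Hsub_components[fr fi cfr cfi inv].
have pg : preserving mu (@act K g) by exact: (act_preserving cK hK Hlambda Hmu).
have [n [g' ag_]] := (GG_autn g).1 Gg.
have ag : autn (n + m) g g' by apply: autn_le ag_; exact: leq_addr.
have mn : (m <= n + m)%N by exact: leq_addl.
have sgr : sq_int mu ((re f) \o act g) by exact: preserving_sq_int.
have sgi : sq_int mu ((im f) \o act g) by exact: preserving_sq_int.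
have cgr := cylindrical_act cK hK Hlambda Hmu cfr ag mn.
have cgi := cylindrical_act cK hK Hlambda Hmu cfi ag mn.
have [p1 [P1 mp1 dp1 _]] := real_projection_exists hK Hmu m sgr cgr.
have [p2 [P2 mp2 dp2 _]] := real_projection_exists hK Hmu m sgi cgi.
have [s1 c1 _] := P1; have [s2 c2 _] := P2.
have inv_act u : U u ->
    (fun k : T => f (act g (conj_act u k))) = (fun k : T => f (act g k)) %[ae mu].
  move=> Uu; have H : (fun k : T => f (conj_act u (act g k))) =
      (fun k : T => f (act g k)) %[ae mu] := preserving_ae pg (inv u Uu).
  by apply: filterS H => k /[apply] <-; rewrite act_conj.
have i1 u : U u -> (fun k : T => p1 (conj_act u k)) = p1 %[ae mu].
  move=> Uu; apply: (real_projection_invariant Uu sgr _ mp1 P1).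
  by apply: filterS (inv_act u Uu) => k /[apply] /= ->.
have i2 u : U u -> (fun k : T => p2 (conj_act u k)) = p2 %[ae mu].
  move=> Uu; apply: (real_projection_invariant Uu sgi _ mp2 P2).
  by apply: filterS (inv_act u Uu) => k /[apply] /= ->.
pose p (k : T) := Complex (p1 k) (p2 k).
have Hp : Hsub mu U m p.
  apply/Hsub_components; split=> // u Uu.
  by apply: filterS2 (i1 u Uu) (i2 u Uu) => k + + _; rewrite /p => /(_ I) -> /(_ I) ->.
have Op : is_orthogonal_projection mu U m (Trep g f) p by exact: complex_projection.
have OT : is_orthogonal_projection mu U m (Trep g f) (Tbar mu U m g f).
  exact: (xgetPex (fun _ => 0) (P := is_orthogonal_projection mu U m (Trep g f)) (ex_intro _ _ Op)).
have pT : p = Tbar mu U m g f %[ae mu] by apply: orthogonal_projection_unique Op OT.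
have [HT _] := OT; have [[mr _] [mi _] _ _ _] := (Hsub_components _).1 HT.
split=> //.
  apply: is_real_projection_ae mr _ P1.
  by apply: filterS pT => k /[apply] <-.
apply: is_real_projection_ae mi _ P2.
by apply: filterS pT => k /[apply] <-.
Qed.

End ComplexProjection.

(* Multiplicativity on double cosets *)
Local Close Scope ring_scope.

Theorem theorem1p2 (R : realType) (m : nat) (K : topologicalGroupType)
    (U : set K) (lambda : probability (borel K) R)
    (mu : probability (borel (Kinf K)) R) :
  (0 < m)%N ->
  compact [set: K] -> hausdorff_space K ->
  closed_subgroup U ->
  haar_probability lambda ->
  product_probability lambda mu ->
  forall A B : set (Finf -> Finf), Gamma m A -> Gamma m B ->
  forall f : borel (Kinf K) -> R[i], Hsub mu U m f ->
    Tbar_dcoset mu U m (circ m A B) f =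
    Tbar_dcoset mu U m A (Tbar_dcoset mu U m B f) %[ae mu].
Proof.
move=> _ cK hK _ Hlambda Hmu A B [g0 Gg0 <-] [h0 Gh0 <-] f Hf.
rewrite /Tbar_dcoset /circ.
set g := dcoset_repr (dcoset m g0); set h := dcoset_repr (dcoset m h0).
have Gg : GG g by apply: dcoset_GG Gg0 (dcoset_reprP _ _).
have Gh : GG h by apply: dcoset_GG Gh0 (dcoset_reprP _ _).
have [n1 [g' ag_]] := (GG_autn g).1 Gg; have [n2 [h' ah_]] := (GG_autn h).1 Gh.
pose n := (m + n1 + n2)%N.
have mn : (m <= n)%N by rewrite /n; lia.
have ag : autn n g g' by apply: autn_le ag_; rewrite /n; lia.
have ah : autn n h h' by apply: autn_le ah_; rewrite /n; lia.
(* The eventual value is attained at some [j] beyond the common rank [n] of [g] and [h], as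
   [real_product] requires. *)
have [j nj ->] := eventual_dcosetE m n Gg Gh.
have nmj : (n <= m + j)%N by lia.
have := dcoset_reprP m (g \o theta m j \o h).
set r := dcoset_repr _ => rD.
have Gr : GG r.
  by apply: dcoset_GG rD; apply: GG_comp => //; apply: GG_comp => //; exact: GG_theta.
have [a Ha [b Hb rE]] := rD.
have proj g1 f1 := @TbarP R K cK hK lambda mu Hlambda Hmu U m f1 g1.
have [Hhf hr hi] := proj h f Gh Hf.
have [_ ghr ghi] := proj g _ Gg Hhf.
have [_ rr ri] := proj r f Gr Hf.
have [fr fi cfr cfi _] := (Hsub_components mu U m f).1 Hf.
(* A component of the right-hand side is a projection of the same function as that of the left-hand
   side; uniqueness then identifies them almost everywhere. *)
have comp (s p p' : borel (Kinf K) -> R) : sq_int mu s -> cylindrical mu m s ->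
    is_real_projection mu m (s \o act h) p ->
    is_real_projection mu m (p \o act g) p' ->
    is_real_projection mu m (s \o act r) p'.
  move=> ss cs Hp [sp' cp' Hp']; split=> // q sq cq; rewrite -Hp' // -rE.
  exact: (real_product cK hK Hlambda Hmu Ha Hb ag ah mn nmj ss cs sq cq Hp).
apply: ae_components.
  exact: (real_projection_unique rr (comp _ _ _ fr cfr hr ghr)).
exact: (real_projection_unique ri (comp _ _ _ fi cfi hi ghi)).
Qed.
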